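(* (i) Every small, $nm$-stable compact $G$-ring is nilpotent-by-finite. (ii) Every small compact $G$-ring of finite ${\cal NM}$-rank is null-by-finite.
   Context: A compact $G$-ring is a pair $(R,G)$ where $R$ is a compact (Hausdorff) topological ring (associative, not necessarily unital or commutative) and $G$ is a Polish group acting faithfully, continuously and by ring automorphisms on $R$. It is small if for every $n$ there are only countably many $G$-orbits on $R^n$. For finite $A\subseteq R$, $G_A$ is the pointwise stabilizer and $o(a/A)=G_A\cdot a$ is the orbit of a finite tuple $a$ over $A$ (with subspace topology). For finite $A\subseteq B$, $a$ is $nm$-independent from $B$ over $A$ if $o(a/B)$ is non-meager in $o(a/A)$. The ${\cal NM}$-rank is defined on orbits analogously to Lascar's U-rank: ${\cal NM}(a/A)\ge 0$ always; ${\cal NM}(a/A)\ge\alpha+1$ iff there is a finite $B\supseteq A$ such that $a$ is not $nm$-independent from $B$ over $A$ and ${\cal NM}(a/B)\ge\alpha$; at limits take intersections; ${\cal NM}(a/A)=\infty$ if it is $\ge$ every ordinal. $(R,G)$ is $nm$-stable if ${\cal NM}(a/A)$ is an ordinal for every finite tuple $a$ and finite $A$. ${\cal NM}(R)$ is the supremum of ${\cal NM}(a/\emptyset)$ for $a\in R$. A ring is nilpotent-by-finite [null-by-finite] if it has a nilpotent ideal [an ideal $I$ with $I\cdot I=\{0\}$] of finite index. *)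

(* Defs.v *)
From HB Require Import structures.
From mathcomp Require Import all_boot all_order all_algebra.
From mathcomp Require Import all_classical all_reals all_analysis.

Set Implicit Arguments.
Unset Strict Implicit.
Unset Printing Implicit Defensive.

Import Order.TTheory GRing.Theory Num.Theory.

Local Open Scope classical_set_scope.
Local Open Scope ring_scope.

HB.structure Definition PreTopologicalGroup :=
  {G of Topological G & Group G}.

HB.mixin Record PreTopologicalGroup_isTopologicalGroup G
    of PreTopologicalGroup G := {
  mulg_continuous : continuous (fun p : G * G => (p.1 * p.2)%g) ;
  invg_continuous : continuous (fun g : G => (g^-1)%g)
}.

#[short(type="topologicalGroupType")]
HB.structure Definition TopologicalGroup :=
  {G of PreTopologicalGroup G & PreTopologicalGroup_isTopologicalGroup G}.

(* MathComp's rings are unital, so the multiplication of a ring which need not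
   be unital is added on top of a topological abelian group. *)
HB.mixin Record TopologicalZmodule_isTopologicalRng R
    of TopologicalZmodule R := {
  rmul : R -> R -> R ;
  rmulA : associative rmul ;
  rmulDl : left_distributive rmul +%R ;
  rmulDr : right_distributive rmul +%R ;
  rmul_continuous : continuous (fun p : R * R => rmul p.1 p.2)
}.

#[short(type="topologicalRngType")]
HB.structure Definition TopologicalRng :=
  {R of TopologicalZmodule R & TopologicalZmodule_isTopologicalRng R}.

Section Polish.
Context (K : realType) (T : topologicalType).

Definition separable := exists2 D : set T, countable D & dense D.

Record complete_compatible_metric (d : T -> T -> K) : Prop := {
  ccm_eq0 : forall x y, d x y = 0 <-> x = y ;
  ccm_sym : forall x y, d x y = d y x ;
  ccm_triangle : forall x y z, d x z <= d x y + d y z ;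
  ccm_nbhs : forall (x : T) (U : set T),
    nbhs x U <-> exists2 e : K, 0 < e & [set y | d x y < e] `<=` U ;
  ccm_complete : forall u : nat -> T,
    (forall e : K, 0 < e -> exists N : nat, forall m n : nat,
      (N <= m)%N -> (N <= n)%N -> d (u m) (u n) < e) ->
    exists l : T, u @ \oo --> l
}.

Definition polish :=
  separable /\ exists d : T -> T -> K, complete_compatible_metric d.

End Polish.

Section Meager.
Context (T : topologicalType).

Definition nowhere_dense (A : set T) := (closure A)° = set0.

Definition meager (A : set T) := exists2 F : nat -> set T,
  (forall i, nowhere_dense (F i)) & A = \bigcup_i F i.

End Meager.

Section Rng.
Context (R : topologicalRngType).
Implicit Types I J : set R.

Record ideal I : Prop := {
  ideal0 : I 0 ;
  idealB : forall x y, I x -> I y -> I (x - y) ;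
  idealMl : forall r x, I x -> I (rmul r x) ;
  idealMr : forall r x, I x -> I (rmul x r)
}.

Definition rmul_set I J : set R := [set rmul x y | x in I & y in J].

(* [rmul_set_exp I n] is the set of all (n + 1)-fold products of elements of
   [I]; it is {0} iff the ideal power of exponent n + 1 is. *)
Definition rmul_set_exp I (n : nat) : set R := iter n (rmul_set I) I.

Definition nilpotent_ideal I :=
  ideal I /\ exists n : nat, rmul_set_exp I n = [set 0].

Definition null_ideal I := ideal I /\ rmul_set I I = [set 0].

Definition finite_index I :=
  finite_set (range (fun x : R => [set (x + y) | y in I])).

Definition nilpotent_by_finite :=
  exists I : set R, nilpotent_ideal I /\ finite_index I.

Definition null_by_finite := exists I : set R, null_ideal I /\ finite_index I.

End Rng.

Record compact_G_ring (K : realType) (R : topologicalRngType)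
    (G : topologicalGroupType) (act : G -> R -> R) : Prop := {
  cgr_compact : compact [set: R] ;
  cgr_hausdorff : hausdorff_space R ;
  cgr_polish : polish K G ;
  cgr_act1 : forall x, act 1%g x = x ;
  cgr_actM : forall g h x, act (g * h)%g x = act g (act h x) ;
  cgr_actD : forall g, {morph act g : x y / x + y} ;
  cgr_act_rmul : forall g, {morph act g : x y / rmul x y} ;
  cgr_faithful : forall g, (forall x, act g x = x) -> g = 1%g ;
  cgr_continuous : continuous (fun p : G * R => act p.1 p.2)
}.

(* A representation of ordinals by well-founded trees: [osup f] denotes the
   supremum of the family [f], so that it covers 0, for an empty family, and
   all limits. Distinct trees may denote the same ordinal. *)
Inductive ordnum : Type :=
  | ozero : ordnum
  | osucc : ordnum -> ordnum
  | osup : forall J : Type, (J -> ordnum) -> ordnum.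

Definition ordnum_of_nat (n : nat) : ordnum := iter n osucc ozero.

Section NMRank.
Context (R : topologicalRngType) (G : topologicalGroupType) (act : G -> R -> R).
Implicit Types A B : set R.

Definition pointwise_stabilizer A : set G :=
  [set g | forall x, A x -> act g x = x].

(* n-tuples, with the product topology *)
Local Notation tup n := {ptws 'I_n -> R}.

Definition orbit_over n (a : tup n) A : set (tup n) :=
  [set ((fun i => act g (a i)) : tup n) | g in pointwise_stabilizer A].

Definition small :=
  forall n : nat, countable (range (fun a : tup n => orbit_over a set0)).

(* [subspace X] gives [X] its subspace topology and makes the points outside [X]
   isolated, so that a subset of [X] is meager in [subspace X] iff it is meager
   in [X]. *)
Definition nm_independent n (a : tup n) A B :=
  ~ meager (orbit_over a B : set (subspace (orbit_over a A))).

Fixpoint NM_ge n (a : tup n) A (alpha : ordnum) : Prop :=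
  match alpha with
  | ozero => True
  | osucc beta => exists B, [/\ finite_set B, A `<=` B,
      ~ nm_independent a A B & NM_ge a B beta]
  | osup J f => forall j : J, NM_ge a A (f j)
  end.

Definition NM_le n (a : tup n) A (alpha : ordnum) :=
  ~ NM_ge a A (osucc alpha).

Definition NM_eq n (a : tup n) A (alpha : ordnum) :=
  NM_ge a A alpha /\ NM_le a A alpha.

Definition nm_stable := forall n (a : tup n) A,
  finite_set A -> exists alpha : ordnum, NM_eq a A alpha.

(* The rank of [R] is the supremum of the ranks of its elements over the empty
   set: it is at most [alpha] iff all of them are. *)
Definition NM_ring_le (alpha : ordnum) :=
  forall x : R, NM_le ((fun=> x) : tup 1) set0 alpha.

Definition finite_NM_rank := exists n : nat, NM_ring_le (ordnum_of_nat n).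

End NMRank.

(* Main.v *)
Require Import Defs.
From HB Require Import structures.
From mathcomp Require Import all_boot all_order all_algebra.
From mathcomp Require Import all_classical all_reals all_analysis.
From mathcomp Require finfield.

(* Write [fi H I] when the closed subgroup [I] has finite index in [H]. If
   [H_0 > H_1 > ...] are closed subgroups, each invariant under the elements near 1
   of the stabilizer of a finite set and each of infinite index in the previous
   one, a Baire category argument finds a point [a] and cosets [b_i + H_i]
   containing it such that the orbit of [a] becomes meager each time [b_i] is added
   to the parameters. So an nm-stable ring has no such infinite chain, and one of
   finite rank bounds their length.

   For (i), call [x] torsion if [J ... J x = 0] for some open ideal [J]. If not all
   of [R] is torsion, take a minimal left ideal [V] that is not. By the chain
   condition [V] is finite-dimensional over a division ring [D] modulo torsion.
   Smallness makes [R] locally finite, so every element of [D] satisfies some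
   [x ^ i = x ^ j], and by Wedderburn each of these equations has finitely many
   solutions: [D] is countable, and Baire shows that [V] is torsion after all.

   For (ii), take a maximal [V0] annihilated by an open subgroup, and [V] minimal
   above it. Finitely many [a_i] give [b V <= sum a_i V], up to finite index, for
   all [b] in an open subgroup. The same countability argument, applied to the
   quasi-endomorphisms [a_i^-1 b] of [V / V0], removes the [a_i] one at a time, so
   [V] is annihilated by an open subgroup up to finite index, a contradiction. *)

Set Implicit Arguments.
Unset Strict Implicit.
Unset Printing Implicit Defensive.

Import Order.TTheory GRing.Theory Num.Theory.

Local Open Scope classical_set_scope.
Local Open Scope ring_scope.

(** * Compact groups *)

(** Two countability principles do most of the work. By Baire, a closed subgroup covered by
    countably many cosets of closed subgroups has finite index over one of them ([fi_of_cosets]). By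
    smallness, a [large] group of automorphisms has countably many orbits, so a closed subgroup on
    which it acts trivially modulo [V] is finite modulo [V] ([fi_of_trivial]); the latter is the
    source of local finiteness. Wedderburn enters because an equation [x ^ i = x ^ j] may have
    infinitely many roots in a noncommutative division ring; counting inside finite subrings, which
    are fields, gives a bound depending on [j] alone. From nm-stability only descending chains are
    extracted, whereas (ii) also needs maximal subgroups: bounded chain length provides them, by
    reading an ascending chain backwards. In (ii) the quotient [a^-1 b] is multivalued and makes
    sense only modulo [residual], the intersection of the subgroups of finite index above [V0]. If
    [residual] is itself of finite index in [V], that quotient carries no information and a
    connectedness argument takes over. *)

Class compact_rng (M : topologicalRngType) : Prop := {
  cg_compact : compact [set: M] ;
  cg_hausdorff : hausdorff_space M }.

Lemma subBB (V : zmodType) (x y z : V) : x - z - (y - z) = x - y.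
Proof. by rewrite opprB addrA subrK. Qed.

Lemma subBD (V : zmodType) (x y z : V) : x - z + (z - y) = x - y.
Proof. by rewrite addrA subrK. Qed.

Lemma subBAC (V : zmodType) (x y z w : V) : x - y - (z - w) = x - z - (y - w).
Proof. by rewrite !opprB addrACA [- y + _]addrC -addrACA. Qed.

Section CompactGroup.
Context {M : topologicalRngType} {chM : compact_rng M}.
Implicit Types (A H I O X Y : set M) (x y : M).

Lemma cts_cvg2 (T : topologicalType) (F : set_system T) (f g : T -> M) x y :
  Filter F -> f @ F --> x -> g @ F --> y -> (fun t => f t + g t) @ F --> x + y.
Proof.
by move=> FF fx gy; apply: (continuous2_cvg FF (h := fun x y => x + y) (@add_continuous M (x, y)) fx gy).
Qed.

Lemma near_sub O : nbhs 0 O ->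
  exists2 O', nbhs 0 O' & forall x y, O' x -> O' y -> O (x - y).
Proof.
move=> nO.
have c : (fun p : M * M => p.1 - p.2) @ (0, 0) --> (0 : M).
  rewrite -[X in _ --> X](subrr 0); apply: cts_cvg2; first exact: cvg_fst.
  apply: (@cvg_comp _ _ _ _ _ _ (nbhs (0 : M))); first exact: cvg_snd.
  by have := @opp_continuous M 0; rewrite /continuous_at.
have [[P Q] /= [nP nQ] PQ] := c _ nO.
exists (P `&` Q); first exact: filterI.
by move=> x y [Px _] [_ Qy]; apply: (PQ (x, y)).
Qed.

Lemma addl_continuous x : continuous (fun y : M => x + y).
Proof. by move=> y; apply: cts_cvg2; [exact: cvg_cst|exact: cvg_id]. Qed.

Lemma subl_continuous x : continuous (fun y : M => x - y).
Proof.
by move=> y; apply: cts_cvg2; [exact: cvg_cst|exact: opp_continuous].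
Qed.

Lemma subr_continuous x : continuous (fun y : M => y - x).
Proof. by move=> y; apply: cts_cvg2; [exact: cvg_id|exact: cvg_cst]. Qed.

Lemma nbhs_add x A : nbhs x A -> nbhs 0 [set y | A (x + y)].
Proof. by have := @addl_continuous x 0; rewrite /continuous_at addr0; apply. Qed.

Lemma nbhs_sub x A : nbhs 0 A -> nbhs x [set y | A (y - x)].
Proof. by have := @subr_continuous x x; rewrite /continuous_at subrr; apply. Qed.

Lemma closed_compact A : closed A -> compact A.
Proof. by move=> cA; apply: subclosed_compact cA cg_compact _. Qed.

Lemma nbhs_closed x A : nbhs x A ->
  exists O, [/\ nbhs x O, closed O & O `<=` A].
Proof.
move=> nA; have [B nB BA] := compact_regular cg_hausdorff cg_compact
  (@filterT _ (nbhs x) _) nA.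
exists (closure B); split=> //; last exact: closed_closure.
by apply: filterS nB; exact: subset_closure.
Qed.

Lemma nbhs_open (T : topologicalType) (x : T) (A : set T) : nbhs x A ->
  exists O : set T, [/\ open O, O x & O `<=` A].
Proof. by rewrite nbhsE => -[ O [oO Ox] OA]; exists O. Qed.

Lemma nested_compact (K : nat -> set M) :
  (forall n, closed (K n)) -> (forall n, K n.+1 `<=` K n) ->
  (forall n, K n !=set0) -> exists x, forall n, K n x.
Proof.
move=> cK dK nK; apply: contrapT => no.
have dKm m n : (m <= n)%N -> K n `<=` K m.
  elim: n => [|n IH]; first by rewrite leqn0 => /eqP->.
  by rewrite leq_eqVlt ltnS => /orP[/eqP->|/IH h x /dK/h].
have c := (compact_near_coveringP _).1 (@cg_compact M chM).
have [] := @c nat \oo (fun n x => ~ K n x) _ _.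
- move=> x _; have [n nKx] : exists n, ~ K n x.
    by apply: contrapT => h; apply: no; exists x => n; apply: contrapT => ?; apply: h; exists n.
  have oC : nbhs x (~` K n) by apply: open_nbhs_nbhs; split=> //; exact/closed_openC.
  exists (~` K n, [set m | (n <= m)%N]); first by split=> //; exists n.
  by move=> [y m] /= [nKy nm] Kmy; apply: nKy; apply: dKm Kmy.
- move=> n _ h; have [x Kx] := nK n.
  by have := h n (leqnn n) x I.
Qed.

Lemma baire A (F : nat -> set M) O : closed A -> open O -> A `&` O !=set0 ->
  (forall n, closed (F n)) -> A `&` O `<=` \bigcup_n F n ->
  exists n O', [/\ open O', A `&` O' !=set0, O' `<=` O & A `&` O' `<=` F n].
Proof.
move=> cA oO AO cF AOF; apply: contrapT => no.
have step (n : nat) (P : set M) : open P -> A `&` P !=set0 -> P `<=` O ->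
    exists Q, [/\ open Q, A `&` Q !=set0, closure Q `<=` P & Q `<=` ~` F n].
  move=> oP AP PO.
  have [x [Ax Px nFx]] : exists x, [/\ A x, P x & ~ F n x].
    apply: contrapT => h; apply: no; exists n, P; split=> // x [Ax Px].
    by apply: contrapT => nF; apply: h; exists x.
  have nx : nbhs x (P `&` ~` F n).
    apply: filterI; apply: open_nbhs_nbhs; split=> //; exact/closed_openC.
  have [C [nC cC CP]] := nbhs_closed nx.
  have [Q [oQ Qx QC]] := nbhs_open nC.
  exists Q; split=> //.
  - by exists x.
  - by move=> y /(closureS QC); rewrite -((closure_id C).1 cC) => /CP[].
  - by move=> y /QC/CP[].
(* The stage number travels with the open set, so that the relation [nx] knows which [F n] to avoid
   next. *)
pose st := {P : nat * set M | [/\ open P.2, A `&` P.2 !=set0 & P.2 `<=` O]}.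
pose nx (s t : st) := [/\ (sval t).1 = (sval s).1.+1,
  closure (sval t).2 `<=` (sval s).2 & (sval t).2 `<=` ~` F (sval s).1].
have [s|f [f0 fS]] := @dependent_choice st nx _ (exist _ (0%N, O) (And3 oO AO (fun _ h => h))).
  case: s => -[n P] [/= oP AP PO]; apply: cid.
  have [Q [oQ AQ QP QF]] := step n P oP AP PO.
  have QO : Q `<=` O by move=> y Qy; apply: PO; apply: QP; exact: subset_closure.
  by exists (exist _ (n.+1, Q) (And3 oQ AQ QO)).
have fn n : (sval (f n)).1 = n.
  by elim: n => [|n IH]; [rewrite f0 | have [-> _ _] := fS n; rewrite IH].
have [|n|n|x xK] := @nested_compact (fun n => A `&` closure (sval (f n.+1)).2).
- by move=> n; apply: closedI => //; exact: closed_closure.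
- move=> x [Ax cx]; split=> //; have [_ h _] := fS n.+1.
  by apply: subset_closure; apply: h.
- have [_ [x [Ax Px]] _] := svalP (f n.+1); exists x; split=> //; exact: subset_closure.
have [Ax _] := xK 0%N.
have xO : O x by have [_ h _] := fS 0%N; have := h _ (xK 0%N).2; rewrite f0.
have [n _ Fnx] := AOF x (conj Ax xO).
have [_ h _] := fS n.+1; have := h _ (xK n.+1).2.
by have [_ _ h' /h'] := fS n; rewrite fn.
Qed.

Record csub H : Prop := {
  csub_closed : closed H ;
  csub0 : H 0 ;
  csubB : forall x y, H x -> H y -> H (x - y) }.

Lemma csubN H x : csub H -> H x -> H (- x).
Proof. by move=> cH Hx; rewrite -sub0r; apply: csubB => //; exact: csub0. Qed.

Lemma csubD H x y : csub H -> H x -> H y -> H (x + y).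
Proof. by move=> cH Hx Hy; rewrite -[y]opprK; apply: csubB => //; exact: csubN. Qed.

Lemma csubT : csub [set: M].
Proof. by split=> //; exact: closedT. Qed.

Lemma csub_set0 : csub [set (0 : M)].
Proof.
split=> // [|x y -> ->]; last by rewrite subr0.
by apply: accessible_closed_set1; apply: hausdorff_accessible; exact: cg_hausdorff.
Qed.

Lemma csubI H I : csub H -> csub I -> csub (H `&` I).
Proof.
move=> cH cI; split; first by apply: closedI; exact: csub_closed.
- by split; exact: csub0.
- by move=> x y [? ?] [? ?]; split; exact: csubB.
Qed.

Lemma csub_bigcap T (D : set T) (F : T -> set M) :
  (forall i, D i -> csub (F i)) -> csub (\bigcap_(i in D) F i).
Proof.
move=> cF; split.
- by apply: closed_bigI => i Di; exact: csub_closed (cF i Di).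
- by move=> i Di; exact: csub0 (cF i Di).
- by move=> x y hx hy i Di; exact: csubB (cF i Di) _ _ (hx i Di) (hy i Di).
Qed.

(* For closed subgroups [I <= H] of a compact group this says that [I] has
   finite index in [H]; stated as a property of germs at 0 it makes sense, and
   is transitive and stable under intersection, for arbitrary sets. *)
Definition fi H I := \forall x \near 0, H x -> I x.

Lemma fiW H I : H `<=` I -> fi H I.
Proof. by move=> HI; apply: nearW => x /HI. Qed.

Lemma fi_trans I H X : fi H I -> fi I X -> fi H X.
Proof. by rewrite /fi; apply: filterS2 => x h h' /h. Qed.

Lemma fiI H I X : fi H I -> fi H X -> fi H (I `&` X).
Proof. by rewrite /fi; apply: filterS2 => x h h' Hx; split; [exact: h|exact: h']. Qed.

Lemma fi_nbhs H I : fi H I -> exists2 O, nbhs 0 O & forall x, O x -> H x -> I x.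
Proof. by move=> h; exists (fun x => H x -> I x). Qed.

(** Compactness turns the germ condition into finitely many translates. The filter of finite lists
    ordered by inclusion makes the near-covering property return one list for all points. *)
Lemma fi_cover H I : csub H -> fi H I ->
  exists s : seq M, (forall c, c \in s -> H c) /\
    forall x, H x -> exists2 c, c \in s & I (x - c).
Proof.
move=> cH fHI.
have c := (compact_near_coveringP _).1 (closed_compact (csub_closed cH)).
pose F := filter_from (fun s : seq M => forall z, z \in s -> H z)
  (fun s => [set t : seq M | (forall z, z \in t -> H z) /\ {subset s <= t}]).
have FF : Filter F.
  apply: filter_from_filter; first by exists [::].
  move=> s t hs ht; exists (s ++ t) => [z|r [hr h]].
    by rewrite mem_cat => /orP[/hs|/ht].
  by split; (split=> // z zs; apply: h; rewrite mem_cat zs ?orbT).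
have [] := @c (seq M) F (fun s x => (forall z, z \in s -> H z) /\
    (H x -> exists2 c, c \in s & I (x - c))).
- move=> x Hx; exists ([set y | H (y - x) -> I (y - x)],
      [set t : seq M | (forall z, z \in t -> H z) /\ {subset [:: x] <= t}]).
    split; first exact: (@nbhs_sub x (fun y => H y -> I y) fHI).
    by exists [:: x] => // z; rewrite inE => /eqP->.
  move=> [y t] /= [h [ht xt]]; split=> // Hy; exists x; first by apply: xt; rewrite inE.
  by apply: h; apply: csubB.
- move=> s hs h; exists s; split=> // x Hx.
  by have [_ /(_ Hx)] := h s (conj hs (fun _ h => h)) x Hx.
Qed.

(* Each [P i] meets [H] inside one coset of [I i]; by Baire one of these
   countably many cosets has interior in [H]. *)
Lemma fi_of_cosets (T : countType) H (I : T -> set M) (P : T -> M -> Prop) :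
  csub H -> (forall i, csub (I i)) ->
  (forall x, H x -> exists i, P i x) ->
  (forall i x y, H x -> H y -> P i x -> P i y -> I i (x - y)) ->
  exists i, fi H (I i).
Proof.
move=> cH cI cov hP.
pose E n : set M := if unpickle n is Some i then
  [set x | H x /\ exists2 c, P i c /\ H c & I i (x - c)] else set0.
have cE n : closed (E n).
  rewrite /E; case: (unpickle n) => [i|]; last exact: closed0.
  case: (pselect (exists c, P i c /\ H c)) => [[c [Pc Hc]]|no]; last first.
    rewrite (_ : mkset _ = set0); first exact: closed0.
    by apply/seteqP; split=> // x [_ [c Pc _]]; apply: no; exists c.
  rewrite (_ : mkset _ = H `&` (fun x => x - c) @^-1` I i).
    apply: closedI; first exact: csub_closed.
    apply: preimage_closed (csub_closed (cI i)) => x _; exact: subr_continuous.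
  apply/seteqP; split=> x [Hx] /=.
    move=> [d [Pd Hd] h]; split=> //=; rewrite -(subBD x c d).
    by apply: csubD => //; exact: hP Pd Pc.
  by split=> //; exists c.
have [||n [ O [oO [x [Hx Ox]] _ OE]]] := baire (csub_closed cH) openT _ cE.
- by exists 0; split=> //; exact: csub0.
- move=> x [Hx _]; have [i Pi] := cov _ Hx.
  exists (pickle i) => //; rewrite /E pickleK; split=> //; exists x => //.
  by rewrite subrr; exact: csub0.
move: OE; rewrite /E; case: (unpickle n) => [i|OE]; last by have [] := OE x.
move=> OE; exists i.
have nx : nbhs x O by apply: open_nbhs_nbhs.
apply: filterS (nbhs_add nx) => y Oy Hy.
have [|_ [c [Pc Hc] h]] := OE (x + y); first by split=> //; exact: csubD.
have [//|_ [d [Pd Hd] h']] := OE x.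
have -> : y = x + y - c - (x - d) + (c - d).
  by rewrite addrAC [_ - c + _]addrA subrK opprB addrA subrK addrAC subrr add0r.
by apply: csubD => //; [apply: csubB|apply: hP].
Qed.

(** A relation [rel] under which the class of [y] modulo [Y'] determines that of [h] modulo [X]
    embeds [H / X] into the finite [Y / Y']. It may be multivalued, as are congruences such as
    [b v = a u] modulo a subgroup. *)
Lemma fi_transport (rel : M -> M -> Prop) H X Y Y' :
  csub H -> csub X -> csub Y -> fi Y Y' ->
  (forall h, H h -> exists2 y, Y y & rel h y) ->
  (forall h h' y y', H h -> H h' -> Y y -> Y y' -> rel h y -> rel h' y' ->
     Y' (y - y') -> X (h - h')) ->
  fi H X.
Proof.
move=> cH cX cY fY ex hX; have [ O0 nO OY'] := fi_nbhs fY.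
have [ O' nO' O'O] := near_sub nO.
have [s [sY cs]] := fi_cover cY (H := Y) (I := O') (filterS (fun _ h _ => h) nO').
pose T := [the countType of 'I_(size s)].
suff: exists i : T, fi H X by case.
apply: (@fi_of_cosets T H (fun=> X)
    (fun i h => exists2 y, Y y & rel h y /\ O' (y - nth 0 s i)) cH) => //.
- move=> h Hh; have [y Yy r] := ex _ Hh; have [c cs' Oc] := cs _ Yy.
  have ic : (index c s < size s)%N by rewrite index_mem.
  by exists (Ordinal ic), y; rewrite //= nth_index.
- move=> i x y Hx Hy [u Yu [ru Ou]] [v Yv [rv Ov]].
  apply: (hX _ _ u v) => //; apply: OY'; last exact: csubB.
  rewrite -(subBB u v (nth 0 s i)).
  exact: O'O.
Qed.

(** Such a subgroup is open in [H], and open subgroups are closed. *)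
Lemma csub_of_fi H I : csub H -> I `<=` H -> I 0 ->
  (forall x y, I x -> I y -> I (x - y)) -> fi H I -> csub I.
Proof.
move=> cH IH I0 IB fHI; split=> // x cx.
have Hx : H x.
  have := csub_closed cH; rewrite closure_id => ->.
  exact: closureS IH _ cx.
have [y [Iy h]] := cx _ (@nbhs_sub x (fun y => H y -> I y) fHI).
have := IB _ _ Iy (h (csubB cH (IH _ Iy) Hx)).
by rewrite opprB addrCA subrr addr0.
Qed.

Lemma closed_image (f : M -> M) H : continuous f -> closed H -> closed (f @` H).
Proof.
move=> cf cH; apply: compact_closed; first exact: cg_hausdorff.
apply: continuous_compact; last exact: closed_compact.
exact: continuous_subspaceT.
Qed.

Lemma csub_image (f : M -> M) H : continuous f -> {morph f : x y / x - y} ->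
  csub H -> csub (f @` H).
Proof.
move=> cf fB cH; split; first by apply: closed_image => //; exact: csub_closed.
- by exists 0; [exact: csub0|rewrite -[X in f X](subrr 0) fB subrr].
- by move=> _ _ [x Hx <-] [y Hy <-]; exists (x - y); [exact: csubB|rewrite fB].
Qed.

Lemma csub_preimage (f : M -> M) H : continuous f -> {morph f : x y / x - y} ->
  csub H -> csub (f @^-1` H).
Proof.
move=> cf fB cH; split.
- by apply: preimage_closed (csub_closed cH) => x _; exact: cf.
- by rewrite /= -[X in f X](subrr 0) fB subrr; exact: csub0.
- by move=> x y /= Hx Hy; rewrite fB; exact: csubB.
Qed.

Definition sumset H I : set M := [set x | exists2 h, H h & I (x - h)].

Lemma sumsetl H I : csub I -> H `<=` sumset H I.
Proof. by move=> cI x Hx; exists x => //; rewrite subrr; exact: csub0. Qed.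

Lemma sumsetr H I : csub H -> I `<=` sumset H I.
Proof. by move=> cH x Ix; exists 0; [exact: csub0|rewrite subr0]. Qed.

Lemma sumset_sub H I X : csub X -> H `<=` X -> I `<=` X -> sumset H I `<=` X.
Proof. by move=> cX HX IX x [h /HX Xh /IX Xi]; rewrite -(subrK h x); exact: csubD. Qed.

Lemma csub_sumset H I : csub H -> csub I -> csub (sumset H I).
Proof.
move=> cH cI; split.
- apply: compact_closed; first exact: cg_hausdorff.
  have -> : sumset H I = (fun p : M * M => p.1 + p.2) @` (H `*` I).
    apply/seteqP; split=> [x [h Hh Ih]|_ [[h i] [/= Hh Ii] <-]].
      by exists (h, x - h) => //=; rewrite addrC subrK.
    by exists h => //; rewrite addrC addKr.
  apply: continuous_compact.
    by apply: continuous_subspaceT => x; exact: add_continuous.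
  by apply: compact_setX; apply: closed_compact; exact: csub_closed.
- by exists 0; [exact: csub0|rewrite subr0; exact: csub0].
- move=> x y [h Hh Ih] [k Hk Ik]; exists (h - k); first exact: csubB.
  by rewrite subBAC; exact: csubB.
Qed.

End CompactGroup.

(** * Actions with countably many orbits *)

Class small_action (R : topologicalRngType) (G : topologicalGroupType)
    (act : G -> R -> R) : Prop := {
  sma_compact : compact_rng R ;
  sma_base : exists P : nat -> set G, forall (g : G) U, nbhs g U ->
    exists2 k, nbhs g (P k) & P k `<=` U ;
  act1 : forall x : R, act 1%g x = x ;
  actM : forall (g h : G) x, act (g * h)%g x = act g (act h x) ;
  actD : forall g, {morph act g : x y / x + y} ;
  act_rmul : forall g, {morph act g : x y / rmul x y} ;
  act_continuous2 : continuous (fun p : G * R => act p.1 p.2) ;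
  sma_small : small act }.

#[export] Existing Instance sma_compact.

Section SmallAction.
Context {R : topologicalRngType} {G : topologicalGroupType} {act : G -> R -> R}
  {sma : small_action act}.
Implicit Types (A B H I V : set R) (D : set G) (g : G) (x y : R).

Local Notation fixes B := (pointwise_stabilizer act B).

Lemma act_continuous g : continuous (act g).
Proof.
move=> x; apply: (continuous2_cvg _ (h := act) (@act_continuous2 _ _ _ sma (g, x))).
  exact: cvg_cst.
exact: cvg_id.
Qed.

Lemma actl_continuous x : continuous (act^~ x).
Proof.
move=> g; apply: (continuous2_cvg _ (h := act) (@act_continuous2 _ _ _ sma (g, x))).
  exact: cvg_id.
exact: cvg_cst.
Qed.

Lemma actK g : cancel (act g) (act g^-1%g).
Proof. by move=> x; rewrite -actM mulVg act1. Qed.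

Lemma actVK g : cancel (act g^-1%g) (act g).
Proof. by move=> x; rewrite -actM mulgV act1. Qed.

Lemma act0 g : act g 0 = 0.
Proof. by apply: (addrI (act g 0)); rewrite -actD !addr0. Qed.

Lemma actN g : {morph act g : x / - x}.
Proof. by move=> x; apply: (addrI (act g x)); rewrite -actD !subrr act0. Qed.

Lemma actB g : {morph act g : x y / x - y}.
Proof. by move=> x y; rewrite actD actN. Qed.

Lemma nbhs_divl g (U : set G) : nbhs 1%g U -> nbhs g [set h | U (g * h^-1)%g].
Proof.
move=> nU; have c : (fun h : G => (g * h^-1)%g) @ g --> (1%g : G).
  rewrite -[X in _ --> X](mulgV g).
  apply: (continuous2_cvg _ (h := fun a b => (a * b)%g) (@mulg_continuous G (g, g^-1%g))).
    exact: cvg_cst.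
  exact: invg_continuous.
exact: c.
Qed.

Lemma nbhs_divr g (U : set G) : nbhs 1%g U -> nbhs g [set h | U (h^-1 * g)%g].
Proof.
move=> nU; have c : (fun h : G => (h^-1 * g)%g) @ g --> (1%g : G).
  rewrite -[X in _ --> X](mulVg g).
  apply: (continuous2_cvg _ (h := fun a b => (a * b)%g) (@mulg_continuous G (g^-1%g, g))).
    exact: invg_continuous.
  exact: cvg_cst.
exact: c.
Qed.

Lemma subset_dense D : D 1%g -> exists d : nat -> G, (forall n, D (d n)) /\
  forall g U, D g -> nbhs g U -> exists n, U (d n).
Proof.
move=> D1; have [P hP] := @sma_base _ _ _ sma.
have ex n : exists g, D g /\ ((P n `&` D) !=set0 -> P n g).
  case: (pselect ((P n `&` D) !=set0)) => [[g [Pg Dg]]|no]; first by exists g.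
  by exists 1%g.
have [d hd] := choice ex; exists d; split=> [n|g U Dg nU]; first by case: (hd n).
have [k nk kU] := hP _ _ nU; exists k; apply: kU; have [_] := hd k; apply.
by exists g; split=> //; exact: nbhs_singleton.
Qed.

(** Group-theoretic counterpart of definability over finitely many parameters: [D] contains a
    neighbourhood of 1 in the pointwise stabilizer of a finite set. *)
Record large D : Prop := {
  large1 : D 1%g ;
  largeM : forall g h, D g -> D h -> D (g * h)%g ;
  largeV : forall g, D g -> D g^-1%g ;
  large_open : exists2 B, finite_set B & \forall g \near 1%g, fixes B g -> D g }.

Lemma large_setT : large setT.
Proof. by split=> //; exists set0 => //; exact: nearW. Qed.

Lemma largeI D E : large D -> large E -> large (D `&` E).
Proof.
move=> bD bE; split.
- by split; exact: large1.
- by move=> g h [? ?] [? ?]; split; exact: largeM.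
- by move=> g [? ?]; split; exact: largeV.
have [B fB hB] := large_open bD; have [C fC hC] := large_open bE.
exists (B `|` C); first by rewrite finite_setU.
apply: filterS2 hB hC => g hB hC fg; split; [apply: hB|apply: hC] => x h.
  by apply: fg; left.
by apply: fg; right.
Qed.

Lemma large_fixes B : finite_set B -> large (fixes B).
Proof.
move=> fB; split.
- by move=> x _; exact: act1.
- by move=> g h fg fh x Bx; rewrite actM fh // fg.
- by move=> g fg x Bx; rewrite -{1}(fg x Bx) actK.
- by exists B => //; apply: nearW.
Qed.

Lemma large_fixes1 x : large [set g | act g x = x].
Proof.
have -> : [set g | act g x = x] = fixes [set x].
  by apply/seteqP; split=> [g gx y ->|g]; [|apply].
exact: large_fixes.
Qed.

(** Smallness on tuples gives countably many orbits over [B], and a neighbourhood of 1 in the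
    separable group [fixes B] has countably many translates covering it. The index is a pair: orbit
    over [B], then translate. *)
Lemma large_orbits D : large D -> exists z : nat * nat -> R,
  forall y, exists i, exists2 g, D g & y = act g (z i).
Proof.
move=> bD; have [B fB hB] := large_open bD.
have [s Bs] := (finite_seqP B).1 fB.
(* Listing [B] after [y] forces any [g] that carries one such tuple to another to fix [B]
   pointwise. *)
pose t y : 'I_(size s).+1 -> R := fun i => nth 0 (y :: s) i.
have /countable_injP [f finj] := @sma_small _ _ _ sma (size s).+1.
pose O y := orbit_over act (t y : {ptws 'I_(size s).+1 -> R}) set0.
have ex k : exists z, (exists y, f (O y) = k) -> f (O z) = k.
  case: (pselect (exists y, f (O y) = k)) => [[y Oy]|no]; first by exists y.
  by exists 0.
have [z hz] := choice ex.
have [d [dB dd]] := @subset_dense (fixes B) (large1 (large_fixes fB)).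
exists (fun i => act (d i.2) (z i.1)) => y.
have : O y = O (z (f (O y))).
  apply/esym/finj; rewrite ?inE; first by exists (t (z (f (O y)))).
    by exists (t y).
  by apply: hz; exists y.
have : O y (t y) by exists 1%g; [|apply/funext => i; rewrite act1].
move=> /[swap] ->; set k := f _ => -[g _ gt].
have yE : y = act g (z k) by have := congr1 (fun u => u ord0) gt.
have fg : fixes B g.
  rewrite Bs => x /= /(nthP 0)[j js <-].
  by have := congr1 (fun u => u (lift ord0 (Ordinal js))) gt.
have [n Dn] := dd g _ fg (nbhs_divl g hB).
exists (k, n), (g * (d n)^-1)%g; last by rewrite yE actM actK.
by apply: Dn; have bB := large_fixes fB; apply: (largeM bB) => //; exact: (largeV bB).
Qed.

(** Each [D]-orbit meets [H] inside a single coset of [V], so countably many cosets cover [H]. *)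
Lemma fi_of_trivial D H V : large D -> csub H -> csub V ->
  (forall g h, D g -> H h -> V (act g h - h)) -> fi H V.
Proof.
move=> bD cH cV hV; have [z hz] := large_orbits bD.
suff: exists i : nat * nat, fi H V by case.
apply: (@fi_of_cosets _ _ _ H (fun=> V) (fun i y => exists2 g, D g & y = act g (z i))) => //.
move=> i x y Hx Hy [g Dg ->] [h Dh yE].
have := hV (g * h^-1)%g y (largeM bD Dg (largeV bD Dh)) Hy.
by rewrite {1}yE actM actK.
Qed.

(** [R] is a countable union of orbits of a second countable group, so the images [act (P k) (z i)]
    form a countable network. Their closures missing 0 exhibit [{0}] as a countable intersection of
    open sets, and in a compact Hausdorff space such a point has a countable base. *)
Lemma base0 : exists U : nat -> set R, [/\ forall k, nbhs 0 (U k),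
  forall k, U k.+1 `<=` U k & forall O, nbhs 0 O -> exists k, U k `<=` O].
Proof.
have [P hP] := @sma_base _ _ _ sma.
have [z hz] := large_orbits large_setT.
pose N (i : nat * (nat * nat)) := closure [set act g (z i.2) | g in P i.1].
pose E n : set R := if unpickle n is Some i then
  if `[< N i 0 >] then setT else ~` N i else setT.
have nE n : nbhs 0 (E n).
  rewrite /E; case: (unpickle n) => [i|]; last exact: filterT.
  case: asboolP => [_|no]; first exact: filterT.
  by apply: open_nbhs_nbhs; split=> //; apply/closed_openC; exact: closed_closure.
have E0 x : (forall n, E n x) -> x = 0.
  move=> Ex; apply: contrapT => x0.
  have nx : nbhs x (~` [set (0 : R)]).
    apply: open_nbhs_nbhs; split=> //; apply/closed_openC.
    exact: csub_closed csub_set0.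
  have [ O' [nO cO OC]] := nbhs_closed nx.
  have [i [g _ xE]] := hz x.
  have := @actl_continuous (z i) g O'; rewrite /continuous_at -xE => /(_ nO)/hP[k nk kO].
  have NO : N (k, i) `<=` O'.
    rewrite /N (closure_id O').1 //; apply: closureS => _ [h Ph <-]; exact: kO.
  have := Ex (pickle (k, i)); rewrite /E pickleK; case: asboolP => [/NO/OC /(_ erefl)//|_]; apply.
  by apply: subset_closure; exists g => //; exact: nbhs_singleton.
have ex (A : set R) : nbhs 0 A -> exists O', [/\ nbhs 0 O', closed O' & O' `<=` A].
  exact: nbhs_closed.
pose st := {A : nat * set R | nbhs 0 A.2 /\ closed A.2}.
have s0 : nbhs (0 : R) setT /\ closed [set: R] by split; [exact: filterT|exact: closedT].
have [s|f [f0 fS]] := @dependent_choice st (fun s t =>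
    (sval t).1 = (sval s).1.+1 /\ (sval t).2 `<=` (sval s).2 `&` E (sval s).1)
  _ (exist _ (0%N, setT) s0).
  case: s => -[n A] [/= nA cA]; apply: cid.
  have [ O' [nO cO OA]] := ex _ (filterI nA (nE n)).
  by exists (exist _ (n.+1, O') (conj nO cO)).
have fn n : (sval (f n)).1 = n.
  by elim: n => [|n IH]; [rewrite f0|have [-> _] := fS n; rewrite IH].
exists (fun n => (sval (f n)).2); split=> [n|n x fx|A nA].
- by case: (svalP (f n)).
- by have [_ h] := fS n; case: (h _ fx).
apply: contrapT => no.
have [ O' [nO oO OA]] : exists O', [/\ nbhs 0 O', open O' & O' `<=` A].
  by have [ O' [oO O0 OA]] := nbhs_open nA; exists O'; split=> //; apply: open_nbhs_nbhs.
have [||n|x hx] := @nested_compact R _ (fun n => (sval (f n)).2 `&` ~` O').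
- move=> n; apply: closedI; first by case: (svalP (f n)).
  exact: open_closedC.
- by move=> n x [fx nx]; split=> //; have [_ h] := fS n; case: (h _ fx).
- apply: contrapT => h; apply: no; exists n => x fx; apply: OA.
  by apply: contrapT => nx; apply: h; exists x.
have x0 : x = 0.
  apply: E0 => n; have [_ h] := fS n; have [_] := h _ (hx n.+1).1.
  by rewrite fn.
have [_] := hx 0%N; apply; rewrite x0; exact: nbhs_singleton.
Qed.

Lemma open_base : exists B : nat * nat -> set R, (forall i, open (B i)) /\
  forall x O, nbhs x O -> exists2 i, B i x & B i `<=` O.
Proof.
have [U [nU _ bU]] := base0.
have oU k : exists W : set R, [/\ open W, W 0 & W `<=` U k] := nbhs_open (nU k).
have [W hW] := choice oU.
have nW k : nbhs 0 (W k) by have [oW W0 _] := hW k; apply: open_nbhs_nbhs.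
have cov k : exists s : seq R, forall x, exists2 c, c \in s & W k (x - c).
  have [s [_ hs]] := fi_cover (@csubT R) (I := W k) (filterS (fun _ h _ => h) (nW k)).
  by exists s => x; have [c] := hs x I; exists c.
have [s hs] := choice cov.
exists (fun i => (fun x => x - nth 0 (s i.1) i.2) @^-1` W i.1); split.
  move=> i; apply: open_comp; last by have [] := hW i.1.
  by move=> x _; exact: subr_continuous.
move=> x O' nO; have [V nV VO] := near_sub (nbhs_add nO).
have [k kV] := bU _ nV.
have [c cs Wc] := hs k x; exists (k, index c (s k)); rewrite /= nth_index //.
move=> y /= Wy; have [_ _ WU] := hW k.
have := VO _ _ (kV _ (WU _ Wy)) (kV _ (WU _ Wc)).
by rewrite /= subBB addrC subrK.
Qed.

(** A closed subgroup of finite index in [V] contains some trace of [U k] on [V], hence also the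
    closed subgroup which that trace generates. *)
Lemma subgroup_base V : csub V -> exists W : nat -> set R,
  [/\ forall k, [/\ csub (W k), W k `<=` V & fi V (W k)],
    forall k, W k.+1 `<=` W k &
    forall Y, csub Y -> fi V Y -> exists k, W k `<=` Y].
Proof.
move=> cV; have [U [nU sU bU]] := base0.
pose F k := [set Y | csub Y /\ V `&` U k `<=` Y].
exists (fun k => \bigcap_(Y in F k) Y); split=> [k|k x hx Y [cY h]|Y cY fY].
- have FV : F k V by split=> // x [].
  split; [by apply: csub_bigcap => Y []|by move=> x; exact|].
  apply: filterS (nU k) => x Ux Vx Y [_]; exact.
- by apply: hx; split=> // y [Vy /sU Uy]; exact: h.
have [ O' nO h] := fi_nbhs fY; have [k kO] := bU _ nO.
by exists k => x; apply; split=> // y [Vy /kO/h]; exact.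
Qed.

(** * Subgroups definable over finitely many parameters *)

Definition stab H : set G := [set g | forall x, H x <-> H (act g x)].

Record defin H : Prop := { defin_csub : csub H ; defin_large : large (stab H) }.

Lemma large_stab H D : large D -> (forall g x, D g -> H x -> H (act g x)) ->
  large (stab H).
Proof.
move=> bD hD; split.
- by move=> x; rewrite act1.
- by move=> g h sg sh x; rewrite actM; exact: iff_trans (sh x) (sg _).
- by move=> g sg x; have := sg (act g^-1%g x); rewrite actVK => e; exact: iff_sym.
have [B fB nB] := large_open bD; exists B => //; apply: filterS nB => g h fg x.
have Dg := h fg; split=> [|Hx]; first exact: hD.
by rewrite -(actK g x); apply: hD => //; exact: largeV.
Qed.

Lemma defin_stab H D : csub H -> large D ->
  (forall g x, D g -> H x -> H (act g x)) -> defin H.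
Proof. by move=> cH bD hD; split=> //; exact: large_stab bD hD. Qed.

Lemma definT : defin setT.
Proof. exact: defin_stab csubT large_setT _. Qed.

Lemma defin_set0 : defin [set 0].
Proof. by apply: defin_stab csub_set0 large_setT _ => g x _ /= ->; rewrite act0. Qed.

Lemma defin_sumset H I : defin H -> defin I -> defin (sumset H I).
Proof.
move=> [cH bH] [cI bI]; apply: defin_stab (csub_sumset cH cI) (largeI bH bI) _.
move=> g x [sH sI] [h Hh Ih]; exists (act g h); first exact: (sH h).1.
by rewrite -actB; exact: (sI _).1.
Qed.

Lemma near_act O : nbhs 0 O -> \forall g \near 1%g, forall x, O (act g x - x).
Proof.
move=> nO; have c : near_covering [set: R] by apply/compact_near_coveringP; exact: cg_compact.
suff cv x : (fun p : R * G => act p.2 p.1 - p.1) @ (x, 1%g) --> (0 : R).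
  apply: filterS (c G (nbhs 1%g) (fun g x => O (act g x - x)) _ (fun x _ => cv x _ nO)).
  by move=> g h x; exact: h.
rewrite -[X in _ --> X](subrr x); apply: cts_cvg2.
  rewrite -[X in _ --> X]act1.
  apply: (continuous2_cvg _ (h := act) (@act_continuous2 _ _ _ sma (1%g, x))).
    exact: cvg_snd.
  exact: cvg_fst.
apply: (@cvg_comp _ _ _ _ -%R _ (nbhs x)); first exact: cvg_fst.
exact: opp_continuous.
Qed.

(** By compactness an element near 1 moves every point by a small amount, so once it preserves [V]
    it fixes all cosets of [I] in [V]. The parameters of [V] therefore suffice for [I]. *)
Lemma defin_fi V I : defin V -> csub I -> I `<=` V -> fi V I -> defin I.
Proof.
move=> [cV bV] cI IV fVI; have [ O' nO h] := fi_nbhs fVI.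
split=> //; have [B fB nB] := large_open bV; split.
- by move=> x; rewrite act1.
- by move=> g k sg sk x; rewrite actM; exact: iff_trans (sk x) (sg _).
- by move=> g sg x; have := sg (act g^-1%g x); rewrite actVK => e; exact: iff_sym.
exists B => //; apply: filterS2 nB (near_act nO) => g sg gO fg.
have st x : V x -> I (act g x - x).
  by move=> Vx; apply: h; [exact: gO|apply: csubB => //; apply: (sg fg x).1].
move=> x; split=> Ix.
  by rewrite -(subrK x (act g x)); apply: csubD => //; apply: st; exact: IV.
have Vx : V x by apply: (sg fg x).2; exact: IV.
rewrite -(subKr (act g x) x); by apply: csubB => //; exact: st.
Qed.

End SmallAction.
Arguments defin {R G} act H.
Arguments large {R G} act D.
Arguments stab {R G} act H.

(** * Chains of definable subgroups *)

Section Chain.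
Context {R : topologicalRngType} {G : topologicalGroupType} {act : G -> R -> R}
  {sma : small_action act}.
Implicit Types (A B H I V Y M : set R) (D : set G) (g : G) (x y a b : R).

Local Notation fixes B := (pointwise_stabilizer act B).

Definition rel_nowhere_dense Y A := closed A /\
  forall O, open O -> Y `&` O !=set0 -> exists x, [/\ Y x, O x & ~ A x].

Definition rel_meager Y M := exists A : nat -> set R,
  (forall k, rel_nowhere_dense Y (A k)) /\ M `<=` \bigcup_k A k.

Definition coset b H : set R := [set y | H (y - b)].

Lemma closed_coset b H : closed H -> closed (coset b H).
Proof. by move=> cH; apply: preimage_closed cH => x _; exact: subr_continuous. Qed.

Lemma coset_self b H : csub H -> coset b H b.
Proof. by move=> cH; rewrite /coset /= subrr; exact: csub0. Qed.

Lemma coset_act b H g y : stab act H g -> act g b = b ->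
  coset b H y <-> coset b H (act g y).
Proof. by move=> sH gb; have := sH (y - b); rewrite actB gb. Qed.

Lemma rel_meagerS Y M M' : M' `<=` M -> rel_meager Y M -> rel_meager Y M'.
Proof. by move=> MM [A [nA MA]]; exists A; split=> // x /MM/MA. Qed.

Lemma rel_nowhere_dense0 Y : rel_nowhere_dense Y set0.
Proof. by split=> [|O _ [x [Yx Ox]]]; [exact: closed0|exists x; split]. Qed.

Lemma rel_meager_bigcup (T : countType) Y (M : T -> set R) :
  (forall i, rel_meager Y (M i)) -> rel_meager Y (\bigcup_i M i).
Proof.
move=> /choice[A hA].
exists (fun n => if unpickle n is Some (i, k) then A i k else set0); split.
  move=> n; case: (unpickle n) => [[i k]|]; last exact: rel_nowhere_dense0.
  by have [h _] := hA i.
move=> x [i _ Mx]; have [_ /(_ _ Mx)[k _ Ax]] := hA i.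
by exists (pickle (i, k)) => //=; rewrite pickleK.
Qed.

Lemma rel_meager_avoid Y M O : closed Y -> rel_meager Y M -> open O ->
  Y `&` O !=set0 -> exists x, [/\ Y x, O x & ~ M x].
Proof.
move=> cY [A [nA MA]] oO YO; apply: contrapT => no.
have [n|x [Yx Ox]|n [U [oU YU UO YA]]] := baire cY oO YO (F := A).
- by case: (nA n).
- by apply: MA; apply: contrapT => nM; apply: no; exists x.
- by have [_ /(_ U oU YU)[x [Yx Ux]]] := nA n; apply; apply: YA.
Qed.

(** Kuratowski-Ulam for the projection modulo [I]. The exceptional fibres are sorted by a basic open
    set [B i] in which the fibre lies inside [A]; each class [E i] turns out to be nowhere dense. *)
Lemma kuratowski_ulam b H I A : csub H -> csub I -> I `<=` H ->
  rel_nowhere_dense (coset b H) A ->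
  rel_meager (coset b H) [set y | coset b H y /\ ~ rel_nowhere_dense (coset y I) A].
Proof.
move=> cH cI IH [cA nA]; have [B [oB bB]] := @open_base _ _ _ sma.
pose E i := [set y | [/\ coset b H y, coset y I `&` B i !=set0 &
  coset y I `&` B i `<=` A]].
suff nE i : rel_nowhere_dense (coset b H) (closure (E i)).
  apply: (@rel_meagerS _ (\bigcup_i E i)); last first.
    apply: rel_meager_bigcup => i; exists (fun=> closure (E i)); split=> // x Ex.
    by exists 0%N => //; exact: subset_closure.
  move=> y [Hy ny]; apply: contrapT => no; apply: ny; split=> // O oO [x [Iy Ox]].
  apply: contrapT => noA.
  have [i Bx BO] := bB x O (open_nbhs_nbhs (conj oO Ox)).
  apply: no; exists i => //; split=> //; first by exists x.
  by move=> z [Iz /BO Oz]; apply: contrapT => nAz; apply: noA; exists z.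
split=> [|O oO [y0 [Hy0 Oy0]]]; first exact: closed_closure.
case: (pselect (O `&` E i !=set0)) => [[y [Oy [Hy [p [Ip Bp]] _]]]|no]; last first.
  exists y0; split=> // /(_ O (open_nbhs_nbhs (conj oO Oy0)))[z [Ez Oz]].
  by apply: no; exists z.
(* Translation by [h] preserves the fibres and carries [y] into [B i]. A point of [B i] outside [A]
   close to [p], translated back, yields an open set free of [E i] near [y]. *)
pose h := p - y; have Ih : I h by [].
have Hp : coset b H p.
  by rewrite /coset /= -(subBD p b y); apply: csubD => //; exact: IH.
have oO' : open [set q | O (q - h)].
  by apply: open_comp => // x _; exact: subr_continuous.
have [|q [Hq [Bq Oq] nAq]] := nA (B i `&` [set q | O (q - h)]) (openI (oB i) oO').
  by exists p; split=> //; split=> //=; rewrite /h opprB addrCA subrr addr0.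
exists (q - h); split=> //.
  by rewrite /coset /= addrAC; apply: csubB => //; exact: IH.
have nz : nbhs (q - h) [set z | (B i `&` ~` A) (z + h)].
  apply: open_nbhs_nbhs; split; last by rewrite /= subrK.
  apply: open_comp; last by apply: openI => //; exact: closed_openC.
  by move=> x _; rewrite -[h]opprK; exact: subr_continuous.
move=> /(_ _ nz)[z [[_ _ Ez] [Bz nAz]]]; apply: nAz; apply: Ez; split=> //.
by rewrite /coset /= addrC addKr.
Qed.

Definition stage_group b B H : set G :=
  [set g | [/\ fixes B g, stab act H g & act g b = b]].

Definition bad_points b B H := [set y | coset b H y /\
  rel_meager (coset b H) [set act g y | g in stage_group b B H]].

(** The stage group has countably many orbits, and those that contain bad points are themselves
    meager. *)
Lemma bad_points_meager b B H : large act (stage_group b B H) ->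
  rel_meager (coset b H) (bad_points b B H).
Proof.
move=> bS; have [z hz] := large_orbits bS.
pose O i := [set act g (z i) | g in stage_group b B H].
apply: (@rel_meagerS _ (\bigcup_i [set y | O i y /\ rel_meager (coset b H) (O i)])).
  move=> y [Hy my]; have [i [g Sg yE]] := hz y; exists i => //; split.
    by exists g.
  apply: rel_meagerS my => _ [h Sh <-]; exists (h * g^-1)%g.
    by apply: (largeM bS) => //; exact: (largeV bS).
  by rewrite yE actM actK.
apply: rel_meager_bigcup => i.
case: (pselect (rel_meager (coset b H) (O i))) => [m|nm].
  by apply: rel_meagerS m => y [].
by exists (fun=> set0); split=> [_|y []//]; exact: rel_nowhere_dense0.
Qed.

Definition governs B b H := \forall g \near 1%g, fixes B g -> stage_group b B H g.

Lemma governs_large b B H : finite_set B -> large act (stab act H) ->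
  governs B b H -> large act (stage_group b B H).
Proof.
move=> fB bH gB; have bF : large act (fixes B) by exact: large_fixes.
split.
- by split=> [x _||]; rewrite ?act1 // => x; rewrite act1.
- move=> g h [fg sg gb] [fh sh hb]; split; last by rewrite actM hb.
    exact: (largeM bF).
  exact: (largeM bH).
- move=> g [fg sg gb]; split; [exact: (largeV bF)|exact: (largeV bH)|].
  by rewrite -[in LHS]gb actK.
by exists B.
Qed.

(* Stage [n] of a Banach-Mazur game producing a point that is bad at no stage:
   the closed sets [F j k] cover the points that are bad at stage [j], and the
   coset chosen at each later stage keeps them nowhere dense. *)
Record stage_ok (H : nat -> set R) (n : nat) b B O (F : nat -> nat -> set R) : Prop := {
  so_open : open O ;
  so_meet : coset b (H n) `&` O !=set0 ;
  so_finite : finite_set B ;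
  so_governs : governs B b (H n) ;
  so_nd : forall j k, rel_nowhere_dense (coset b (H n)) (F j k) ;
  so_bad : bad_points b B (H n) `<=` \bigcup_k F n k }.

(** [kuratowski_ulam] supplies [b'] in whose finer coset all earlier [F j k] remain nowhere dense.
    The parameters of [H n.+1] and [b'] are then adjoined, and [O'] is shrunk around a point
    avoiding every [F' j k], so as to miss finitely many of them. *)
Lemma stage_step (H : nat -> set R) n b B O F :
  (forall i, defin act (H i)) -> (forall i, H i.+1 `<=` H i) ->
  stage_ok H n b B O F ->
  exists b' B' O' F', stage_ok H n.+1 b' B' O' F' /\
    [/\ coset b (H n) b', B `<=` B', closure O' `<=` O,
        forall j k, (j <= n)%N -> F' j k = F j k &
        forall j k, (j <= n.+1)%N -> (k <= n.+1)%N -> O' `<=` ~` F' j k].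
Proof.
move=> dH sH [oO YO fB bS nF badF].
have cH i := defin_csub (dH i).
have [||b' [Hb' Ob' nb']] := @rel_meager_avoid (coset b (H n))
    (\bigcup_(i : nat * nat) [set y | coset b (H n) y /\
       ~ rel_nowhere_dense (coset y (H n.+1)) (F i.1 i.2)]) O _ _ oO YO.
- exact: closed_coset (csub_closed (cH _)).
- by apply: rel_meager_bigcup => i; apply: kuratowski_ulam.
have [C fC nC] := large_open (defin_large (dH n.+1)).
pose B' := B `|` (C `|` [set b']).
have fB' : finite_set B' by rewrite !finite_setU; split=> //; split.
have gB' : governs B' b' (H n.+1).
  apply: filterS nC => g sg fg; split=> //.
    by apply: sg => x Cx; apply: fg; right; left.
  by apply: fg; right; right.
have bS' := governs_large fB' (defin_large (dH n.+1)) gB'.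
have [D [nD badD]] := bad_points_meager bS'.
pose F' j := if j == n.+1 then D else F j.
have nF' j k : rel_nowhere_dense (coset b' (H n.+1)) (F' j k).
  rewrite /F'; case: eqP => [_|_]; first exact: nD.
  by apply: contrapT => h; apply: nb'; exists (j, k).
have [|||z [Hz Oz nz]] := @rel_meager_avoid (coset b' (H n.+1))
    (\bigcup_(i : nat * nat) F' i.1 i.2) O _ _ oO.
- exact: closed_coset (csub_closed (cH _)).
- by apply: rel_meager_bigcup => i; exists (fun=> F' i.1 i.2); split=> // x; exists 0%N.
- by exists b'; split=> //; exact: coset_self.
have nN : nbhs z (O `&` [set x | forall p : 'I_n.+2 * 'I_n.+2, ~ F' p.1 p.2 x]).
  apply: filterI; first exact: open_nbhs_nbhs.
  apply: filter_forall => p; apply: open_nbhs_nbhs; split.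
    by apply: closed_openC; have [] := nF' p.1 p.2.
  by move=> h; apply: nz; exists (p.1 : nat, p.2 : nat).
have [Q [nQ cQ QN]] := nbhs_closed nN; have [ O' [oO' Oz' OC']] := nbhs_open nQ.
exists b', B', O', F'; split.
  split=> //; first by exists z.
  by rewrite /F' eqxx.
split=> //.
- by move=> x Bx; left.
- by move=> x /(closureS OC'); rewrite -((closure_id Q).1 cQ) => /QN[].
- by move=> j k jn; rewrite /F'; case: eqP => // jE; rewrite jE ltnn in jn.
- move=> j k jn kn x /OC'/QN[_ h].
  exact: h (Ordinal (jn : (j < n.+2)%N), Ordinal (kn : (k < n.+2)%N)).
Qed.


Local Notation tup y := ((fun=> y) : {ptws 'I_1 -> R}).

Lemma tup_continuous : continuous (fun y : R => tup y).
Proof.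
have -> : (fun y : R => tup y) = dfwith (tup 0) ord0.
  by apply/funext => y; apply/funext => i; rewrite (ord1 i) dfwithin.
exact: dfwith_continuous.
Qed.

Lemma act_closed g A : closed A -> closed (act g @^-1` A).
Proof. by move=> cA; apply: preimage_closed cA => x _; exact: act_continuous. Qed.

Lemma closure_tup (A : set {ptws 'I_1 -> R}) C t : closed C ->
  A `<=` [set tup y | y in C] -> closure A t -> C (t ord0).
Proof.
move=> cC AC; have cl : closed (proj ord0 @^-1` C : set {ptws 'I_1 -> R}).
  by apply: preimage_closed cC => x _; exact: proj_continuous.
have h : A `<=` proj ord0 @^-1` C by move=> _ /AC[y Cy <-].
by move=> /(closureS h); rewrite -((closure_id _).1 cl).
Qed.

(** The orbit over [B'] splits into countably many pieces [F k], each inside a translate of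
    [b' + H']. If one of them were somewhere dense in the orbit over [B], points of that orbit near
    [a] would lie in [b' + H']; countably many translates [e j (b' + H')], nowhere dense because
    [H'] has infinite index, would then cover the stage orbit of [a], making [a] bad. *)
Lemma dependent_meager b B H b' B' H' a :
  csub H -> csub H' -> H' `<=` H -> finite_set B' ->
  coset b H b' -> coset b' H' a -> B `<=` B' -> finite_set B ->
  large act (stage_group b B H) -> governs B' b' H' ->
  ~ bad_points b B H a -> ~ fi H H' ->
  meager (orbit_over act (tup a) B' : set (subspace (orbit_over act (tup a) B))).
Proof.
move=> cH cH' HH fB' Hb' Ha BB fB bS gS' nbad nfi.
have bB' : large act (fixes B') by exact: large_fixes.
have BB' : fixes B' `<=` fixes B by move=> g fg x /BB; exact: fg.
have [d [dB dd]] := subset_dense (large1 bB').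
pose O := orbit_over act (tup a) B.
pose F k : set {ptws 'I_1 -> R} := [set tup (act (d k * g)%g a) | g in stage_group b' B' H'].
have FO k : F k `<=` O.
  move=> _ [g [fg _ _] <-]; exists (d k * g)%g => //.
  by apply: BB'; apply: (largeM bB').
have nF k : nowhere_dense (F k : set (subspace O)).
  apply/seteqP; split=> // t nt.
  have ct := nbhs_singleton nt.
  have [clF Ot] : closure (F k : set {ptws 'I_1 -> R}) t /\ O t.
    by move: ct; rewrite (@closure_subspaceW _ O (F k) (FO k)) => -[].
  pose T := {ptws 'I_1 -> R}.
  have {}nt : within O (@nbhs T T t) (closure (F k : set (subspace O))).
    rewrite (@nbhs_subspace_in T O t Ot); exact: nt.
  have {}nt : @nbhs T T t (fun u => O u -> closure (F k : set T) u).
    by apply: filterS nt => u; rewrite (closure_subspaceW (FO k)) => -[].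
  have [U [oU Ut hU]] := nbhs_open nt.
  have [_ [[g [fg sg gb] <-] Ug]] := clF _ (open_nbhs_nbhs (conj oU Ut)).
  have {}nt : @nbhs T T (tup (act (d k * g)%g a)) (fun u => O u -> closure (F k : set T) u).
    exact: filterS hU (open_nbhs_nbhs (conj oU Ug)).
  have Sg : stage_group b' B' H' g by [].
  have dg : fixes B (d k * g)%g by apply: BB'; apply: (largeM bB').
  have nW : nbhs a [set x | O (tup (act (d k * g)%g x)) ->
      coset b' H' x].
    have c : (fun x => tup (act (d k * g)%g x)) @ a --> tup (act (d k * g)%g a).
      apply: (@cvg_comp _ _ _ (act (d k * g)%g) (fun y => tup y) _ _ _
        (@act_continuous _ _ _ sma _ a)).
      exact: tup_continuous.
    have cn : nbhs a ((fun x => tup (act (d k * g)%g x)) @^-1`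
        (fun u => O u -> closure (F k : set T) u)) := c _ nt.
    apply: filterS cn => x h Ox.
    have cC := @act_closed (d k)^-1%g _ (closed_coset (b := b') (csub_closed cH')).
    have /= := closure_tup cC _ (h Ox); rewrite actM actK => hx.
    apply: (coset_act _ sg gb).2; apply: hx => _ [k' [fk sk kb] <-].
    exists (act (d k * k')%g a) => //=; rewrite actM actK.
    exact: (coset_act _ sk kb).1.
  apply: nbad; split.
    rewrite /coset /= -(subBD a b b'); apply: csubD => //; exact: HH.
  have [e [eS de]] := subset_dense (large1 bS).
  exists (fun j => act (e j)^-1%g @^-1` coset b' H'); split.
    move=> j; split.
      exact: act_closed (closed_coset (b := b') (csub_closed cH')).
    move=> U0 oU0 [x0 [Hx0 Ux0]]; apply: contrapT => no; apply: nfi.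
    have nx : nbhs 0 [set h | U0 (x0 + act (e j) h)].
      have c : (fun h => x0 + act (e j) h) @ (0 : R) --> x0.
        rewrite -[X in _ --> X]addr0 -[X in _ --> _ + X](act0 (e j)); apply: cts_cvg2; first exact: cvg_cst.
        exact: act_continuous.
      exact: c _ (open_nbhs_nbhs (conj oU0 Ux0)).
    have [_ sj _] := eS j.
    have out x : coset b H x -> U0 x -> coset b' H' (act (e j)^-1%g x).
      by move=> Hx Ux; apply: contrapT => nx'; apply: no; exists x.
    apply: filterS nx => h Uh Hh.
    have Hxh : coset b H (x0 + act (e j) h).
      by rewrite /coset /= addrAC; apply: csubD => //; exact: (sj h).1.
    have := csubB cH' (out _ Hxh Uh) (out _ Hx0 Ux0).
    by rewrite subBB actD actK addrC addKr.
  move=> _ [h Sh <-].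
  have nU : nbhs 1%g [set h' | coset b' H' (act h' a) \/ ~ O (tup (act (d k * g * h')%g a))].
    have c : (act^~ a) @ 1%g --> a by rewrite -[X in _ --> X](act1 a); exact: actl_continuous.
    have cn : nbhs 1%g (act^~ a @^-1` [set x | O (tup (act (d k * g)%g x)) ->
      coset b' H' x]) := c _ nW.
    apply: filterS cn => h' /= hW.
    case: (pselect (O (tup (act (d k * g * h')%g a)))) => [Oh|]; last by right.
    by left; apply: hW; rewrite -actM.
  have [j /= hj] := de _ _ Sh (nbhs_divr h nU).
  exists j => //=; rewrite -actM; case: hj => // nO; exfalso; apply: nO.
  exists (d k * g * ((e j)^-1 * h))%g => //.
  have bB : large act (fixes B) by exact: large_fixes.
  apply: (largeM bB dg); apply: (largeM bB); last by case: Sh.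
  by apply: (largeV bB); case: (eS j).
exists (fun k => F k) => //.
apply/seteqP; split=> [_ [g fg <-]|t [k _ [g [fg _ _] <-]]]; last first.
  by exists (d k * g)%g => //; apply: (largeM bB').
have [k hk] := dd _ _ fg (nbhs_divr g gS').
exists k => //; exists ((d k)^-1 * g)%g.
  by apply: hk; apply: (largeM bB') => //; exact: (largeV bB').
by rewrite mulgA mulgV mul1g.
Qed.

Lemma generic_point (H : nat -> set R) : H 0%N = setT ->
  (forall i, defin act (H i)) -> (forall i, H i.+1 `<=` H i) ->
  exists a (B : nat -> set R), [/\ B 0%N = set0, forall n, finite_set (B n),
    forall n, B n `<=` B n.+1 & forall n, ~ fi (H n) (H n.+1) ->
    meager (orbit_over act (tup a) (B n.+1) :
      set (subspace (orbit_over act (tup a) (B n))))].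
Proof.
move=> H0 dH sH; have cH i := defin_csub (dH i).
pose data := (nat * ((R * set R) * (set R * (nat -> nat -> set R))))%type.
pose ok (s : data) := stage_ok H s.1 s.2.1.1 s.2.1.2 s.2.2.1 s.2.2.2.
pose st := {s : data | ok s}.
have g0 : governs set0 0 (H 0%N).
  by apply: nearW => g _; split=> // [x|]; rewrite ?H0 ?act0.
have [D [nD badD]] : rel_meager (coset 0 (H 0%N)) (bad_points 0 set0 (H 0%N)).
  by apply/bad_points_meager/governs_large => //; exact: defin_large.
have ok0 : ok (0%N, ((0, set0), (setT, fun j => if j == 0%N then D else fun=> set0))).
  split=> //; first exact: openT.
  - by exists 0; split=> //; exact: coset_self.
  - by move=> j k /=; case: (j == 0%N) => //; exact: rel_nowhere_dense0.
have [s|f [f0 fS]] := @dependent_choice st (fun s t =>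
    let: (n, ((b, B), (U, F))) := sval s in
    let: (n', ((b', B'), (U', F'))) := sval t in
    n' = n.+1 /\ [/\ coset b (H n) b', B `<=` B', closure U' `<=` U,
        forall j k, (j <= n)%N -> F' j k = F j k &
        forall j k, (j <= n.+1)%N -> (k <= n.+1)%N -> U' `<=` ~` F' j k])
  _ (exist _ _ ok0).
  case: s => -[n [[b B] [U F]]] oks; apply: cid.
  have [b' [B' [ O' [F' [ok' h]]]]] := stage_step dH sH oks.
  by exists (exist _ (n.+1, ((b', B'), (O', F'))) ok').
pose b n := (sval (f n)).2.1.1; pose B n := (sval (f n)).2.1.2.
pose O n := (sval (f n)).2.2.1; pose F n := (sval (f n)).2.2.2.
have fn n : (sval (f n)).1 = n.
  elim: n => [|n IH]; first by rewrite f0.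
  move: (fS n) IH; case: (sval (f n)) => [m [[? ?] [? ?]]].
  by case: (sval (f n.+1)) => [m' [[? ?] [? ?]]] [-> _] /= ->.
have okn n : stage_ok H n (b n) (B n) (O n) (F n).
  by rewrite -{1}(fn n); exact: (svalP (f n)).
have step n : [/\ coset (b n) (H n) (b n.+1), B n `<=` B n.+1,
    closure (O n.+1) `<=` O n,
    forall j k, (j <= n)%N -> F n.+1 j k = F n j k &
    forall j k, (j <= n.+1)%N -> (k <= n.+1)%N -> O n.+1 `<=` ~` F n.+1 j k].
  move: (fS n) (fn n); rewrite /b /B /O /F.
  case: (sval (f n)) => [m [[? ?] [? ?]]].
  by case: (sval (f n.+1)) => [m' [[? ?] [? ?]]] [_ h] /= <-.
have [|n x [Hx Ox]|n|a ha] :=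
    @nested_compact R _ (fun n => coset (b n) (H n) `&` closure (O n)).
- by move=> n; apply: closedI; [exact: closed_coset (csub_closed (cH n))|exact: closed_closure].
- have [Hb _ OO _ _] := step n; split.
    rewrite /coset /= -(subBD x (b n) (b n.+1)); apply: csubD => //; exact: sH.
  by apply: subset_closure; exact: OO.
- have [_ [x [Hx Ox]] _ _ _ _] := okn n.
  by exists x; split=> //; exact: subset_closure.
have aO n : O n a by have [_ _ OO _ _] := step n; apply: OO; case: (ha n.+1).
have FE n m k : (n <= m)%N -> F m n k = F n n k.
  elim: m => [|m IH]; first by rewrite leqn0 => /eqP->.
  rewrite leq_eqVlt => /orP[/eqP->//|]; rewrite ltnS => nm.
  by have [_ _ _ h _] := step m; rewrite h // IH.
have nbad n : ~ bad_points (b n) (B n) (H n) a.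
  have [_ _ _ _ _ bn] := okn n => /bn[k _ Fa].
  (* The open set of stage [(maxn n k).+1] already avoids [F n k], which has not changed since stage
     [n]. *)
  have [_ _ _ _ h] := step (maxn n k).
  apply: (h n k _ _ a (aO _)); rewrite ?leqW ?leq_maxl ?leq_maxr //.
  by rewrite FE // leqW // leq_maxl.
have fB n : finite_set (B n) by case: (okn n).
exists a, B; split=> //; first by rewrite /B f0.
  by move=> n; case: (step n).
move=> n nfi; have [Hb BB _ _ _] := step n.
apply: (@dependent_meager (b n) (B n) (H n) (b n.+1) (B n.+1) (H n.+1)) => //.
- by case: (ha n.+1).
- by apply: governs_large => //; [exact: defin_large|case: (okn n)].
- by case: (okn n.+1).
Qed.

Lemma nm_stable_dcc : nm_stable act -> forall H : nat -> set R,
  (forall i, defin act (H i)) -> (forall i, H i.+1 `<=` H i) ->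
  exists i, fi (H i) (H i.+1).
Proof.
move=> stb H dH sH; apply: contrapT => no.
(* Prefixing [setT] meets the normalisation in [generic_point]; over every [B n.+1] the rank of [a]
   then exceeds each ordinal, one dependent step at a time. *)
pose K n := if n is m.+1 then H m else setT.
have [|||a [B [_ fB sB dep]]] := @generic_point K; rewrite //.
- by case=> [|n]; [exact: definT|exact: dH].
- by case=> [|n] //; exact: sH.
have ge alpha n : NM_ge act (tup a) (B n.+1) alpha.
  elim: alpha n => [//|beta IH n|J h IH n j]; last exact: IH.
  exists (B n.+2); split=> //; apply; apply: dep => fK; apply: no; by exists n.
by have [alpha [_]] := stb _ (tup a) _ (fB 1%N); apply; exact: ge.
Qed.

Lemma finite_rank_dcc n : NM_ring_le act (ordnum_of_nat n) -> forall H : nat -> set R,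
  (forall i, defin act (H i)) -> (forall i, H i.+1 `<=` H i) ->
  exists2 i, (i <= n)%N & fi (H i) (H i.+1).
Proof.
move=> rk H dH sH; apply: contrapT => no.
(* Overwriting [H 0] instead of shifting keeps all [n.+1] steps with index at most [n]; if [H 1] has
   finite index in [setT], it does in [H 0] too. *)
pose K n := if n is 0 then setT else H n.
have [|||a [B [B0 fB sB dep]]] := @generic_point K; rewrite //.
- by case=> [|m]; [exact: definT|exact: dH].
- by case=> [|m] //; exact: sH.
have ge m k : (m + k = n.+1)%N -> NM_ge act (tup a) (B k) (ordnum_of_nat m).
  elim: m k => [//|m IH k mk]; exists (B k.+1); split=> //; last first.
    by apply: IH; rewrite addnS -addSn.
  apply; apply: dep => fK; apply: no; exists k.
    by rewrite -ltnS -mk addSn ltnS leq_addl.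
  by case: k mk fK => [|k] _ //=; rewrite /fi; apply: filterS => x h _; exact: h.
by apply: (rk a); have := ge n.+1 0%N (addn0 _); rewrite B0.
Qed.

End Chain.

(** * Locally finite domains *)

(* [x ^ (n + 1)] for a possibly non-unital product. *)
Definition spow (T : Type) (mul : T -> T -> T) (x : T) (n : nat) := iter n (mul x) x.

Lemma few_power_coincidences (F : idomainType) (X : seq F) i j :
  (i < j)%N -> uniq X -> (forall x, x \in X -> x ^+ i.+1 = x ^+ j.+1) ->
  (size X <= j.+1)%N.
Proof.
move=> ij uX hX; pose p : {poly F} := 'X^(j.+1) - 'X^(i.+1).
have sp : size p = j.+2.
  by rewrite size_polyDl ?size_polyN ?size_polyXn // ltnS ltnS.
have p0 : p != 0 by rewrite -size_poly_eq0 sp.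
have := @max_poly_roots F p X p0; rewrite sp ltnS; apply=> //.
by apply/allP => x xX; rewrite /root /p !hornerE subr_eq0 hX.
Qed.

Lemma finite_domain_roots (Q : finZmodType) (mul : Q -> Q -> Q) (X : seq Q) i j :
  associative mul -> left_distributive mul +%R -> right_distributive mul +%R ->
  (forall x y, mul x y = 0 -> x = 0 \/ y = 0) ->
  (i < j)%N -> uniq X -> (forall x, x \in X -> spow mul x i = spow mul x j) ->
  (size X <= j.+1)%N.
Proof.
move=> mA mDl mDr dom ij uX hX.
have m0 x : mul x 0 = 0 by apply: (addrI (mul x 0)); rewrite -mDr !addr0.
have m0' x : mul 0 x = 0 by apply: (addrI (mul 0 x)); rewrite -mDl !addr0.
have mN x y : mul x (- y) = - mul x y.
  by apply: (addrI (mul x y)); rewrite -mDr !subrr.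
have mN' x y : mul (- x) y = - mul x y.
  by apply: (addrI (mul x y)); rewrite -mDl !subrr.
have injl a : a <> 0 -> injective (mul a).
  move=> a0 x y /eqP; rewrite -subr_eq0 -mN -mDr => /eqP/dom[//|/eqP].
  by rewrite subr_eq0 => /eqP.
have injr a : a <> 0 -> injective (mul^~ a).
  move=> a0 x y /= /eqP; rewrite -subr_eq0 -mN' -mDl => /eqP/dom[/eqP|//].
  by rewrite subr_eq0 => /eqP.
case: (pselect (exists a : Q, a <> 0)) => [[a a0]|no]; last first.
  have Q0 (x : Q) : x = 0 by apply: contrapT => x0; apply: no; exists x.
  case: X uX {hX} => [//|x [//|y X]] /=; rewrite inE.
  by rewrite (Q0 x) (Q0 y) eqxx.
(* No unit is given: multiplication by a nonzero [a] is injective, hence bijective on a finite set,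
   and the solution of [a e = a] is a two-sided unit by cancellation. *)
pose e := invF (injl a a0) a.
have ae : mul a e = a by exact: (f_invF (injl a a0)).
have e1 x : mul e x = x by apply: (injl a a0); rewrite mA ae.
have e2 x : mul x e = x by apply: (injr a a0); rewrite /= -mA e1.
have e0 : e != 0 by apply/eqP => e0; have := ae; rewrite e0 m0 => /esym h; case: (a0 h).
pose inv x := if pselect (x <> 0) is left h then invF (injr x h) e else x.
have invl x : x != 0 -> mul (inv x) x = e.
  by move=> /eqP x0; rewrite /inv; case: pselect => // h; exact: (f_invF (injr x h)).
have invr x : x != 0 -> mul x (inv x) = e.
  move=> x0; have ix0 : inv x <> 0.
    by move=> h; have := invl x x0; rewrite h m0' => /esym/eqP; apply/negP.
  by apply: (injl _ ix0); rewrite mA invl // e1 e2.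
pose rM := GRing.Zmodule_isNzRing.Build Q mA e1 e2 mDl mDr e0.
pose R : finNzRingType := HB.pack (Finite.sort Q) rM.
have iU (x y : R) : (y * x = 1) /\ (x * y = 1) -> (x : Q) != 0.
  move=> [_ xy]; apply/eqP => x0; move: xy; rewrite x0 => /eqP.
  by rewrite (m0' y : (0 : R) * y = 0) eq_sym; apply/negP.
have i0 : {in [predC [pred x : R | (x : Q) != 0]], inv =1 id}.
  by move=> x; rewrite inE /= negbK => /eqP->; rewrite /inv; case: pselect.
pose uM := GRing.NzRing_hasMulInverse.Build R invl invr iU i0.
pose U : finUnitRingType := HB.pack (FinRing.NzRing.sort R) uM.
have dU : GRing.integral_domain_axiom U.
  by move=> x y /dom[->|->]; rewrite eqxx ?orbT.
(* Wedderburn's theorem: commutativity makes the bound on polynomial roots available. *)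
pose F := finfield.FinDomainFieldType dU.
have powE (x : F) n : x ^+ n.+1 = spow mul x n.
  by elim: n => [|n IH]; [rewrite expr1|rewrite exprS IH].
by apply: (@few_power_coincidences F X i j) => // x xX; rewrite !powE hX.
Qed.

(** * The quotient of [S] by [I] as a finite ring of representatives *)

Section Quotient.
Variables (T : zmodType) (mul : T -> T -> T) (S I : set T).
Hypotheses (S0 : S 0) (SB : forall x y, S x -> S y -> S (x - y))
  (SM : forall x y, S x -> S y -> S (mul x y)).
Hypotheses (I0 : I 0) (IB : forall x y, I x -> I y -> I (x - y)).
Hypothesis absorb : forall x y, S x -> S y -> I x \/ I y -> I (mul x y).
Hypothesis dom : forall x y, S x -> S y -> I (mul x y) -> I x \/ I y.
Hypothesis assoc : forall x y z, S x -> S y -> S z ->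
  I (mul x (mul y z) - mul (mul x y) z).
Hypothesis distl : forall x y z, S x -> S y -> S z ->
  I (mul (x + y) z - (mul x z + mul y z)).
Hypothesis distr : forall x y z, S x -> S y -> S z ->
  I (mul x (y + z) - (mul x y + mul x z)).
Variable s : seq T.
Hypothesis cover : forall x, S x -> exists2 c, c \in s & S c /\ I (x - c).

Let cg x y := I (x - y).

Let cg_refl x : cg x x. Proof. by rewrite /cg subrr. Qed.

Let IN x : I x -> I (- x). Proof. by rewrite -sub0r; exact: IB. Qed.

Let cg_sym x y : cg x y -> cg y x.
Proof. by move=> /IN; rewrite opprB. Qed.

Let cg_trans y x z : cg x y -> cg y z -> cg x z.
Proof. by move=> xy /cg_sym zy; have := IB xy zy; rewrite subBB. Qed.

Let SN x : S x -> S (- x). Proof. by rewrite -sub0r; exact: SB. Qed.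

Let SD x y : S x -> S y -> S (x + y).
Proof. by move=> Sx Sy; rewrite -[y]opprK; apply: SB => //; exact: SN. Qed.

(** [choose] gives congruent points equal predicates and hence the same representative, so classes
    become a finite subtype of [T] that can carry a ring structure. *)
Let rep x := choose (fun y => `[< S y /\ cg x y >]) x.

Let repP x : S x -> S (rep x) /\ cg x (rep x).
Proof.
move=> Sx; have h : `[< S x /\ cg x x >] by apply/asboolP.
by have /asboolP := @chooseP T (fun y => `[< S y /\ cg x y >]) x h.
Qed.

Let rep_eq x y : S x -> S y -> cg x y -> rep x = rep y.
Proof.
move=> Sx Sy xy; rewrite /rep (_ : (fun z => _) = (fun z => `[< S z /\ cg y z >])).
  by apply: choose_id; apply/asboolP; split=> //; exact: cg_sym.
apply/funext => z; apply: asbool_equiv_eq; split=> -[Sz h]; split=> //.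
  exact: cg_trans (cg_sym xy) h.
exact: cg_trans xy h.
Qed.

Let r := [seq rep c | c <- [seq c <- s | `[< S c >]]].

Let rep_in x : S x -> rep x \in r.
Proof.
move=> Sx; have [c cs [Sc xc]] := cover Sx; rewrite (rep_eq Sx Sc xc).
by apply: map_f; rewrite mem_filter cs andbT; apply/asboolP.
Qed.

Let Q := seq_sub r.

Let SQ (q : Q) : S (ssval q).
Proof.
have /mapP[c] := ssvalP q; rewrite mem_filter => /andP[/asboolP Sc _] ->.
by case: (repP Sc).
Qed.

Let q0 : Q := SeqSub (rep_in S0).

Let cls x : Q := if pselect (S x) is left Sx then SeqSub (rep_in Sx) else q0.

Let clsP x : S x -> cg x (ssval (cls x)).
Proof. by move=> Sx; rewrite /cls; case: pselect => // Sx'; case: (repP Sx'). Qed.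

Let cls_eq x y : S x -> S y -> cg x y -> cls x = cls y.
Proof.
move=> Sx Sy xy; rewrite /cls; case: pselect => // Sx'; case: pselect => // Sy'.
by apply: val_inj; exact: rep_eq.
Qed.

Let cls_cg x y : S x -> S y -> cls x = cls y -> cg x y.
Proof.
by move=> Sx Sy xy; apply: cg_trans (clsP Sx) _; rewrite xy; apply: cg_sym; exact: clsP.
Qed.

Let clsK (q : Q) : cls (ssval q) = q.
Proof.
have /mapP[c] := ssvalP q; rewrite mem_filter => /andP[/asboolP Sc _] qE.
rewrite /cls; case: pselect => [Sq|[]]; last exact: SQ.
apply: val_inj; rewrite /= {2}qE; apply: rep_eq => //.
by rewrite qE; apply: cg_sym; case: (repP Sc).
Qed.

Let cgD x y x' y' : cg x x' -> cg y y' -> cg (x + y) (x' + y').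
Proof.
move=> hx hy; rewrite /cg opprD addrACA -[y - y']opprK.
by apply: IB => //; exact: IN.
Qed.

Let cgM x y x' y' : S x -> S y -> S x' -> S y' -> cg x x' -> cg y y' ->
  cg (mul x y) (mul x' y').
Proof.
move=> Sx Sy Sx' Sy' hx hy; apply: (@cg_trans (mul x' y)).
  have Sd := SB Sx Sx'.
  have := distl Sd Sx' Sy; rewrite subrK => h.
  apply: (@cg_trans (mul (x - x') y + mul x' y)); first exact: h.
  rewrite /cg addrK; apply: absorb => //; by left.
have Sd := SB Sy Sy'.
have := distr Sx' Sd Sy'; rewrite subrK => h.
apply: (@cg_trans (mul x' (y - y') + mul x' y')); first exact: h.
rewrite /cg addrK; apply: absorb => //; by right.
Qed.

Let qadd (p q : Q) := cls (ssval p + ssval q).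
Let qopp (p : Q) := cls (- ssval p).
Let qmul (p q : Q) := cls (mul (ssval p) (ssval q)).

Let clsD x y : S x -> S y -> qadd (cls x) (cls y) = cls (x + y).
Proof.
by move=> Sx Sy; apply: cls_eq; try exact: SD; apply: cgD; apply: cg_sym; exact: clsP.
Qed.

Let clsM x y : S x -> S y -> qmul (cls x) (cls y) = cls (mul x y).
Proof.
by move=> Sx Sy; apply: cls_eq; try exact: SM;
  apply: cgM => //; apply: cg_sym; exact: clsP.
Qed.

Let qaddA : associative qadd.
Proof.
move=> p q t; rewrite -(clsK p) -(clsK q) -(clsK t).
by rewrite !clsD ?addrA //; exact: SD.
Qed.

Let qaddC : commutative qadd.
Proof. by move=> p q; rewrite /qadd addrC. Qed.

Let qadd0 : left_id (cls 0) qadd.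
Proof. by move=> p; rewrite -(clsK p) clsD // add0r. Qed.

Let qaddN : left_inverse (cls 0) qopp qadd.
Proof. by move=> p; rewrite -[X in qadd _ X](clsK p) clsD ?addNr //; exact: SN. Qed.

Let zM := GRing.isZmodule.Build Q qaddA qaddC qadd0 qaddN.
Let zQ : finZmodType := HB.pack (seq_sub r) zM.

Lemma few_roots (X : seq T) i j : (i < j)%N -> uniq X ->
  (forall x, x \in X -> S x /\ I (spow mul x i - spow mul x j)) ->
  (forall x y, x \in X -> y \in X -> I (x - y) -> x = y) -> (size X <= j.+1)%N.
Proof.
move=> ij uX hX inc.
have SX x : x \in X -> S x by move=> /hX[].
rewrite -(size_map cls).
have powE x n : S x -> S (spow mul x n) /\ spow qmul (cls x) n = cls (spow mul x n).
  move=> Sx; elim: n => [|n [Sn IH]] //=; rewrite /spow /= -!/(spow _ _ _) IH clsM //.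
  by split=> //; exact: SM.
apply: (@finite_domain_roots zQ qmul _ i j) => //.
- move=> p q t; rewrite -(clsK p) -(clsK q) -(clsK t) !clsM //; try exact: SM.
  by apply: cls_eq; [apply: SM => //; exact: SM|apply: SM => //; exact: SM|exact: assoc].
- move=> p q t; rewrite -[p]clsK -[q]clsK -[t]clsK.
  rewrite -[(_ + _ in LHS)]/(qadd _ _) -[RHS]/(qadd _ _) clsD // !clsM //; last exact: SD.
  rewrite clsD; [|exact: SM..].
  by apply: cls_eq; [by apply: SM => //; exact: SD|by apply: SD; exact: SM|exact: distl].
- move=> p q t; rewrite -[p]clsK -[q]clsK -[t]clsK.
  rewrite -[(_ + _ in LHS)]/(qadd _ _) -[RHS]/(qadd _ _) clsD // !clsM //; last exact: SD.
  rewrite clsD; [|exact: SM..].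
  by apply: cls_eq; [by apply: SM => //; exact: SD|by apply: SD; exact: SM|exact: distr].
- have z x : S x -> I x -> cls x = cls 0 by move=> Sx Ix; apply: cls_eq => //; rewrite /cg subr0.
  move=> p q; rewrite -(clsK p) -(clsK q) clsM // => h.
  have := cls_cg (SM (SQ p) (SQ q)) S0 h; rewrite /cg subr0.
  by move=> /(dom (SQ p) (SQ q))[] ?; [left|right]; exact: z.
- by rewrite map_inj_in_uniq // => x y xX yX h; apply: inc => //; apply: cls_cg h; exact: SX.
- move=> _ /mapP[x xX ->]; have [Sx hx] := hX x xX.
  have [Si ->] := powE x i Sx; have [Sj ->] := powE x j Sx.
  exact: cls_eq.
Qed.

End Quotient.

(* [S] is a subring and [I] an ideal of it up to [I] itself: the ring axioms are
   only required modulo [I]. *)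
Record finite_domain_mod (T : zmodType) (mul : T -> T -> T) (S I : set T) : Prop := {
  fdm0 : S 0 ;
  fdmB : forall x y, S x -> S y -> S (x - y) ;
  fdmM : forall x y, S x -> S y -> S (mul x y) ;
  fdm_absorb : forall x y, S x -> S y -> I x \/ I y -> I (mul x y) ;
  fdm_dom : forall x y, S x -> S y -> I (mul x y) -> I x \/ I y ;
  fdmA : forall x y z, S x -> S y -> S z -> I (mul x (mul y z) - mul (mul x y) z) ;
  fdmDl : forall x y z, S x -> S y -> S z -> I (mul (x + y) z - (mul x z + mul y z)) ;
  fdmDr : forall x y z, S x -> S y -> S z -> I (mul x (y + z) - (mul x y + mul x z)) ;
  fdm_finite : exists s : seq T, forall x, S x -> exists2 c, c \in s & S c /\ I (x - c) }.

Lemma pigeonhole (T : eqType) (s : seq T) (f : nat -> T) : (forall n, f n \in s) ->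
  exists i j, (i < j)%N /\ f i = f j.
Proof.
move=> fs; apply: contrapT => no.
have u : uniq [seq f n | n <- iota 0 (size s).+1].
  rewrite map_inj_uniq ?iota_uniq // => i j fij; apply: contrapT => /eqP.
  by rewrite neq_ltn => /orP[] h; apply: no; [exists i, j|exists j, i].
have := uniq_leq_size u (s2 := s); rewrite size_map size_iota ltnn => h.
by suff : false by []; apply: h => _ /mapP[n _ ->].
Qed.

(* Each element of a finite ring satisfies some [x ^ i = x ^ j], and in a finite
   domain, which is a field by Wedderburn, a given pair [(i, j)] has few
   solutions. *)
Lemma countable_classes (T : zmodType) (mul : T -> T -> T) (A I : set T) :
  I 0 -> (forall x y, I x -> I y -> I (x - y)) ->
  (forall X : seq T, (forall x, x \in X -> A x) -> exists2 S,
     (forall x, x \in X -> S x) & finite_domain_mod mul S I) ->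
  exists c : (nat * nat) * nat -> T, forall x, A x -> exists2 k, A (c k) & I (x - c k).
Proof.
move=> I0 IB loc.
case: (pselect (exists x, A x)) => [[x0 Ax0]|no]; last first.
  by exists (fun=> 0) => x Ax; case: no; exists x.
pose E (p : nat * nat) := [set x | [/\ A x, (p.1 < p.2)%N & I (spow mul x p.1 - spow mul x p.2)]].
have ex p : exists s : seq T, (forall x, x \in s -> A x) /\
    forall x, E p x -> exists2 c, c \in s & I (x - c).
  apply: contrapT => no.
  have long n : exists X : seq T, [/\ size X = n, uniq X, (forall x, x \in X -> E p x) &
      forall x y, x \in X -> y \in X -> I (x - y) -> x = y].
    elim: n => [|n [X [sX uX XE inc]]]; first by exists [::].
    apply: contrapT => nolong; apply: no; exists X; split=> [x /XE[]//|x Ex].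
    apply: contrapT => nocov; apply: nolong.
    have xX c : c \in X -> ~ I (x - c) by move=> cX Ixc; apply: nocov; exists c.
    have sym a b : I (a - b) -> I (b - a).
      by move=> /(IB _ _ I0); rewrite sub0r opprB.
    exists (x :: X); split=> [|||a b]; rewrite /= ?sX //.
    - by rewrite uX andbT; apply/negP => /xX; rewrite subrr.
    - by move=> a; rewrite inE => /orP[/eqP->//|/XE].
    rewrite !inE => /orP[/eqP->|aX] /orP[/eqP->|bX] // h.
    - by case: (xX _ bX).
    - by case: (xX _ aX); exact: sym.
    - exact: inc.
  (* One element more than the bound [p.2.+1] of [few_roots]. *)
  have [X [sX uX XE inc]] := long p.2.+2.
  have [S XS fS] := loc X (fun x xX => let: And3 Ax _ _ := XE x xX in Ax).
  have [s hs] := fdm_finite fS.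
  have ij : (p.1 < p.2)%N.
    by case: X sX XE {uX inc XS} => // x X _ /(_ x (mem_head _ _)) [].
  have := few_roots (fdm0 fS) (fdmB fS) (fdmM fS) I0 IB (fdm_absorb fS) (fdm_dom fS)
    (fdmA fS) (fdmDl fS) (fdmDr fS) hs ij uX _ inc.
  rewrite sX ltnn => h; suff : false by [].
  by apply: h => x xX; split; [exact: XS|case: (XE _ xX)].
have [s hs] := choice ex.
exists (fun k => nth x0 (s k.1) k.2) => x Ax.
have [S XS fS] := loc [:: x] (fun y => ltac:(by rewrite inE => /eqP->)).
have Sx : S x by apply: XS; rewrite inE.
have Sp n : S (spow mul x n).
  by elim: n => [//|n IH]; exact: (fdmM fS).
have [t ht] := fdm_finite fS.
have [c hc] := choice (fun n => let: ex_intro2 c ct h := ht _ (Sp n) in ex_intro _ c (conj ct h.2)).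
have [i [j [ij cij]]] := pigeonhole (fun n => (hc n).1).
have Exij : E (i, j) x.
  split=> //=; rewrite -(subBB _ _ (c i)); apply: IB; first exact: (hc i).2.
  by rewrite cij; exact: (hc j).2.
have [sA /(_ _ Exij)[d ds Id]] := hs (i, j).
by exists ((i, j), index d (s (i, j))); rewrite /= nth_index //; exact: sA.
Qed.

(** * Torsion with respect to the open ideals *)

Section CompactRng.
Context {R : topologicalRngType} {chR : compact_rng R}.
Implicit Types (A H I J K L V : set R) (r s x y : R).

Lemma rmulr0 r : rmul r 0 = 0.
Proof. by apply: (addrI (rmul r 0)); rewrite -rmulDr !addr0. Qed.

Lemma rmul0r r : rmul 0 r = 0.
Proof. by apply: (addrI (rmul 0 r)); rewrite -rmulDl !addr0. Qed.

Lemma rmulBr r : {morph rmul r : x y / x - y}.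
Proof.
move=> x y; rewrite rmulDr; congr (_ + _).
by apply: (addrI (rmul r y)); rewrite -rmulDr !subrr rmulr0.
Qed.

Lemma rmulBl r : {morph rmul^~ r : x y / x - y}.
Proof.
move=> x y; rewrite /= rmulDl; congr (_ + _).
by apply: (addrI (rmul y r)); rewrite -rmulDl !subrr rmul0r.
Qed.

Lemma rmull_continuous r : continuous (rmul r).
Proof.
move=> x; apply: (continuous2_cvg _ (h := @rmul R) (@rmul_continuous R (r, x))).
  exact: cvg_cst.
exact: cvg_id.
Qed.

Lemma rmulr_continuous r : continuous (rmul^~ r).
Proof.
move=> x; apply: (continuous2_cvg _ (h := @rmul R) (@rmul_continuous R (x, r))).
  exact: cvg_id.
exact: cvg_cst.
Qed.

Lemma near_rmul O : nbhs 0 O -> \forall r \near (0 : R), forall x, O (rmul r x).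
Proof.
move=> nO; have c : near_covering [set: R] by apply/compact_near_coveringP; exact: cg_compact.
suff cv x : (fun p : R * R => rmul p.2 p.1) @ (x, 0) --> (0 : R).
  apply: filterS (c R (nbhs (0 : R)) (fun r x => O (rmul r x)) _ (fun x _ => cv x _ nO)).
  by move=> r h x; exact: h.
rewrite -[X in _ --> X](rmul0r x).
apply: (continuous2_cvg _ (h := @rmul R) (@rmul_continuous R (0, x))).
  exact: cvg_snd.
exact: cvg_fst.
Qed.

Lemma near_rmulr O : nbhs 0 O -> \forall r \near (0 : R), forall x, O (rmul x r).
Proof.
move=> nO; have c : near_covering [set: R] by apply/compact_near_coveringP; exact: cg_compact.
suff cv x : (fun p : R * R => rmul p.1 p.2) @ (x, 0) --> (0 : R).
  apply: filterS (c R (nbhs (0 : R)) (fun r x => O (rmul x r)) _ (fun x _ => cv x _ nO)).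
  by move=> r h x; exact: h.
rewrite -[X in _ --> X](rmulr0 x).
apply: (continuous2_cvg _ (h := @rmul R) (@rmul_continuous R (x, 0))).
  exact: cvg_fst.
exact: cvg_snd.
Qed.

Lemma csub_ideal I : ideal I -> nbhs 0 I -> csub I.
Proof.
move=> iI nI; apply: (csub_of_fi (@csubT R)) => //.
- exact: ideal0.
- exact: idealB.
- by apply: filterS nI.
Qed.

Lemma open_finite_index I : ideal I -> nbhs 0 I -> finite_index I.
Proof.
move=> iI nI; have cI := csub_ideal iI nI.
have [s [_ hs]] := fi_cover (@csubT R) (I := I) (filterS (fun _ h _ => h) nI).
apply: (@sub_finite_set _ _ ((fun x : R => [set (x + y) | y in I]) @` [set` s])).
  move=> _ [x _ <-]; have [c cs Ic] := hs x Logic.I; exists c => //.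
  apply/seteqP; split=> _ [y Iy <-].
    exists (y - (x - c)); first exact: csubB.
    by rewrite addrCA subKr addrC.
  exists (x - c + y); first exact: csubD.
  by rewrite addrA [c + _]addrCA subrr addr0.
by apply: finite_image; exact: finite_seq.
Qed.

(** In the absence of a unit, [r], [R r], [r R] and [R r R] must be put inside [A] separately; each
    condition is open by uniform smallness of products near 0. *)
Lemma open_subgroup_ideal A : csub A -> nbhs 0 A ->
  exists2 I, ideal I & nbhs 0 I /\ I `<=` A.
Proof.
move=> cA nA.
pose I := [set r | [/\ A r, forall s, A (rmul s r), forall s, A (rmul r s) &
  forall s t, A (rmul s (rmul r t))]].
exists I; first split.
- by split=> [|s|s|s t]; rewrite ?rmulr0 ?rmul0r ?rmulr0; exact: csub0.
- move=> x y [x1 x2 x3 x4] [y1 y2 y3 y4]; split=> [|s|s|s t].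
  + exact: csubB.
  + by rewrite rmulBr; exact: csubB.
  + by rewrite rmulBl; exact: csubB.
  + by rewrite rmulBl rmulBr; exact: csubB.
- move=> r x [x1 x2 x3 x4]; split=> // [s|s|s t].
  + by rewrite rmulA.
  + by rewrite -rmulA.
  + by rewrite -rmulA rmulA.
- move=> r x [x1 x2 x3 x4]; split=> // [s|s t].
  + by rewrite -rmulA.
  + by rewrite -rmulA.
split; last by move=> x [].
have nA' := near_rmulr nA.
apply: filterS2 (filterI nA nA') (filterI (near_rmul nA) (near_rmul nA')) => r [? ?] [? h].
by split=> // s t; exact: h.
Qed.

Definition lideal V := csub V /\ forall r x, V x -> V (rmul r x).

Lemma lidealT : lideal setT. Proof. by split=> //; exact: csubT. Qed.

Lemma lideal_image L x : lideal L -> lideal (rmul^~ x @` L).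
Proof.
move=> [cL mL]; split.
  by apply: csub_image => //; [exact: rmulr_continuous|exact: rmulBl].
by move=> r _ [s Ls <-]; exists (rmul r s); [exact: mL|rewrite rmulA].
Qed.

Fixpoint tors J k : set R :=
  if k is k'.+1 then [set v | forall r, J r -> tors J k' (rmul r v)] else [set 0].

Lemma tors_lideal J k : ideal J -> lideal (tors J k).
Proof.
move=> iJ; elim: k => [|k [ck mk]] /=.
  by split; [exact: csub_set0|move=> r x ->; rewrite rmulr0].
split; last by move=> r x h s Js; rewrite rmulA; apply: h; exact: (Defs.idealMr iJ).
have -> : [set v | forall r, J r -> tors J k (rmul r v)] =
    \bigcap_(r in J) rmul r @^-1` tors J k by [].
by apply: csub_bigcap => r _; apply: csub_preimage => //;
  [exact: rmull_continuous|exact: rmulBr].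
Qed.

Lemma tors_sub J J' k : J' `<=` J -> tors J k `<=` tors J' k.
Proof. by move=> JJ; elim: k => [//|k IH] x h r /JJ Jr; apply: IH; exact: h. Qed.

Lemma torsS J k : tors J k `<=` tors J k.+1.
Proof.
by elim: k => [|k IH] x h r Jr /=; [rewrite h /= rmulr0|apply: IH; exact: h].
Qed.

Lemma tors_exp J k A : ideal J -> A `<=` tors J k -> A !=set0 ->
  iter k (rmul_set J) A = [set 0].
Proof.
move=> iJ; elim: k A => [|k IH] A hA A0.
  by apply/seteqP; split=> [x /hA//|x /= ->]; case: A0 => y Ay; rewrite -(hA _ Ay).
rewrite iterSr IH // => [_ [r Jr [x Ax <-]]|]; first exact: (hA x Ax).
by case: A0 => y Ay; exists (rmul 0 y); exists 0; [exact: ideal0|exists y].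
Qed.

End CompactRng.

Class ideal_base (R : topologicalRngType) (J : nat -> set R) : Prop := {
  ib_ideal : forall j, ideal (J j) ;
  ib_nbhs : forall j, nbhs 0 (J j) ;
  ib_dec : forall j, J j.+1 `<=` J j ;
  ib_cofinal : forall I : set R, ideal I -> nbhs 0 I -> exists j, J j `<=` I }.

Section Torsion.
Context {R : topologicalRngType} {chR : compact_rng R} {J : nat -> set R}
  {baseJ : ideal_base J}.
Implicit Types (A H I K L V : set R) (r s x y : R).
Let iJ := @ib_ideal _ _ baseJ.
Let nJ := @ib_nbhs _ _ baseJ.
Let sJ := @ib_dec _ _ baseJ.
Let bJ := @ib_cofinal _ _ baseJ.

(** The diagonal of the two-parameter family [tors (J j) k]: it is increasing, since shrinking the
    ideal and raising the exponent both enlarge it, and it has the same union. *)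
Definition tor n := tors (J n) n.
Definition torsion := \bigcup_n tor n.

Lemma ideals_le m n : (m <= n)%N -> J n `<=` J m.
Proof.
elim: n => [|n IH]; first by rewrite leqn0 => /eqP->.
by rewrite leq_eqVlt ltnS => /orP[/eqP->|/IH h x /sJ/h].
Qed.

Lemma tor_lideal n : lideal (tor n). Proof. exact: tors_lideal. Qed.

Lemma tor_le m n : (m <= n)%N -> tor m `<=` tor n.
Proof.
elim: n => [|n IH]; first by rewrite leqn0 => /eqP->.
rewrite leq_eqVlt ltnS => /orP[/eqP->|/IH h] // x /h.
by move=> /torsS/(tors_sub (@sJ n)).
Qed.

Lemma tor_div j n x : (forall r, J j r -> tor n (rmul r x)) -> tor (maxn j n).+1 x.
Proof.
move=> h; apply: (tors_sub (@sJ _)) => r Jr; apply: (@tor_le n); first exact: leq_maxr.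
by apply: h; apply: ideals_le Jr; exact: leq_maxl.
Qed.

Lemma torsionB x y : torsion x -> torsion y -> torsion (x - y).
Proof.
move=> [m _ hx] [n _ hy]; exists (maxn m n) => //.
apply: (csubB (tor_lideal _).1); [apply: tor_le hx|apply: tor_le hy].
  exact: leq_maxl.
exact: leq_maxr.
Qed.

Lemma torsionM r x : torsion x -> torsion (rmul r x).
Proof. by move=> [n _ hx]; exists n => //; exact: (tor_lideal n).2. Qed.

Lemma torsion0 : torsion 0.
Proof. by exists 0%N. Qed.

Lemma torsionD x y : torsion x -> torsion y -> torsion (x + y).
Proof.
move=> hx hy; rewrite -[y]opprK; apply: torsionB => //.
by rewrite -sub0r; apply: torsionB => //; exact: torsion0.
Qed.

(** The multipliers from [L] into [L'] form an ideal, open because [r R] is small for [r] near 0.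
    This is why torsion is insensitive to finite index: passing from [L] to [L'] costs a single
    factor from [J j]. *)
Lemma ideal_mul_sub L L' : lideal L -> lideal L' -> fi L L' ->
  exists j, forall r, J j r -> forall x, L x -> L' (rmul r x).
Proof.
move=> [cL mL] [cL' mL'] fL.
suff [j hj] : exists j, J j `<=` [set r | forall x, L x -> L' (rmul r x)].
  by exists j => r /hj.
apply: bJ.
  split.
  - by move=> x Lx; rewrite rmul0r; exact: csub0.
  - by move=> r s hr hs x Lx; rewrite rmulBl; apply: csubB => //; [exact: hr|exact: hs].
  - by move=> r s hs x Lx; rewrite -rmulA; apply: mL'; exact: hs.
  - by move=> r s hs x Lx; rewrite -rmulA; apply: hs; exact: mL.
have [ O' nO h] := fi_nbhs fL.
by apply: filterS (near_rmul nO) => r Or x Lx; apply: h => //; exact: mL.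
Qed.

(** By Baire some [tor n] already has finite index over [L], and one further factor absorbs the
    remaining cosets; torsion thus acquires a uniform exponent. *)
Lemma lideal_torsion L : lideal L -> L `<=` torsion -> exists n, L `<=` tor n.
Proof.
move=> lL LN.
have [n fn] : exists n, fi L (tor n).
  apply: (@fi_of_cosets R _ nat L tor tor lL.1) => [n|x /LN[n _ h]|n x y _ _ hx hy].
  - exact: (tor_lideal n).1.
  - by exists n.
  - exact: csubB (tor_lideal n).1 _ _ hx hy.
have [j hj] := ideal_mul_sub lL (tor_lideal n) fn.
by exists (maxn j n).+1 => x Lx; apply: tor_div => r /hj; exact.
Qed.

Lemma torsion_mul_sub L L' : lideal L -> lideal L' -> fi L L' ->
  forall y, (forall r, L' r -> torsion (rmul r y)) ->
  forall r, L r -> torsion (rmul r y).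
Proof.
move=> lL lL' fL y h r Lr.
have [_ [s Ls <-]|n hn] := lideal_torsion (lideal_image y lL'); first exact: h.
have [j hj] := ideal_mul_sub lL lL' fL.
exists (maxn j n).+1 => //; apply: tor_div => s Js; apply: hn.
by exists (rmul s r); [exact: hj|rewrite rmulA].
Qed.

Lemma torsion_fi L L' : lideal L -> lideal L' -> fi L L' -> L' `<=` torsion ->
  L `<=` torsion.
Proof.
move=> lL lL' fL h x Lx; have [n hn] := lideal_torsion lL' h.
have [j hj] := ideal_mul_sub lL lL' fL.
by exists (maxn j n).+1 => //; apply: tor_div => s Js; apply: hn; exact: hj.
Qed.

Lemma torsion_div j x : (forall r, J j r -> torsion (rmul r x)) -> torsion x.
Proof.
move=> h; have lJ : lideal (J j).
  by split; [exact: csub_ideal|move=> r y; exact: Defs.idealMl].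
have [_ [s Js <-]|n hn] := lideal_torsion (lideal_image x lJ); first exact: h.
by exists (maxn j n).+1 => //; apply: tor_div => r Jr; apply: hn; exists r.
Qed.

Lemma nilpotent_by_finite_torsion : setT `<=` torsion -> nilpotent_by_finite R.
Proof.
move=> /(lideal_torsion lidealT)[n hn].
exists (J n); split; last exact: open_finite_index.
split=> //; exists n; apply: tors_exp => //; first by move=> x _; exact: hn.
by exists 0; exact: ideal0.
Qed.

End Torsion.
Arguments tor {R} J n.
Arguments torsion {R} J.

(** * nm-stable rings *)

Section Definable.
Context {R : topologicalRngType} {G : topologicalGroupType} {act : G -> R -> R}
  {sma : small_action act}.
Implicit Types (A B H I L V W Y : set R) (D : set G) (g : G) (a r s x y : R).

Local Notation fixes B := (pointwise_stabilizer act B).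

Lemma ideal_base_exists : exists J : nat -> set R, ideal_base J.
Proof.
have [U [nU sU bU]] := base0.
exists (fun j => \bigcap_(I in [set I | ideal I /\ U j `<=` I]) I); split.
- move=> j; split.
  + by move=> I [iI _]; exact: ideal0.
  + by move=> x y hx hy I hI; apply: (idealB hI.1); [exact: hx|exact: hy].
  + by move=> r x hx I hI; apply: (Defs.idealMl hI.1); exact: hx.
  + by move=> r x hx I hI; apply: (Defs.idealMr hI.1); exact: hx.
- by move=> j; apply: filterS (nU j) => x Ux I [_]; exact.
- by move=> j x hx I [iI UI]; apply: hx; split=> // y /sU/UI.
- by move=> I iI nI; have [k kI] := bU _ nI; exists k => x; apply.
Qed.

Lemma defin_imager L x : defin act L -> defin act (rmul^~ x @` L).
Proof.
move=> [cL bL]; apply: defin_stab (largeI bL (large_fixes1 x)) _.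
  by apply: csub_image => //; [exact: rmulr_continuous|exact: rmulBl].
move=> g _ [sL gx] [r Lr <-]; exists (act g r); first exact: (sL r).1.
by rewrite act_rmul gx.
Qed.

Lemma defin_imagel a V : defin act V -> defin act (rmul a @` V).
Proof.
move=> [cV bV]; apply: defin_stab (largeI bV (large_fixes1 a)) _.
  by apply: csub_image => //; [exact: rmull_continuous|exact: rmulBr].
move=> g _ [sV ga] [r Vr <-]; exists (act g r); first exact: (sV r).1.
by rewrite act_rmul ga.
Qed.

Lemma csub_divr A W x : csub A -> csub W -> csub [set r | A r /\ W (rmul r x)].
Proof.
move=> cA cW; apply: csubI => //; apply: csub_preimage => //.
  exact: rmulr_continuous.
exact: rmulBl.
Qed.

Lemma csub_divl A W a : csub A -> csub W -> csub [set v | A v /\ W (rmul a v)].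
Proof.
move=> cA cW; apply: csubI => //; apply: csub_preimage => //.
  exact: rmull_continuous.
exact: rmulBr.
Qed.

Lemma defin_divr A W x : defin act A -> defin act W ->
  defin act [set r | A r /\ W (rmul r x)].
Proof.
move=> [cA bA] [cW bW].
apply: defin_stab (csub_divr _ cA cW) (largeI bA (largeI bW (large_fixes1 x))) _.
move=> g r [sA [sW gx]] [Ar Wr]; split; first exact: (sA r).1.
by rewrite -gx -act_rmul; exact: (sW _).1.
Qed.

Lemma defin_divl A W a : defin act A -> defin act W ->
  defin act [set v | A v /\ W (rmul a v)].
Proof.
move=> [cA bA] [cW bW].
apply: defin_stab (csub_divl _ cA cW) (largeI bA (largeI bW (large_fixes1 a))) _.
move=> g r [sA [sW ga]] [Ar Wr]; split; first exact: (sA r).1.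
by rewrite -ga -act_rmul; exact: (sW _).1.
Qed.

Lemma fi_divr A V W x : (forall r, A r -> V (rmul r x)) -> fi V W ->
  fi A [set r | A r /\ W (rmul r x)].
Proof.
move=> AV fV; have c := @rmulr_continuous R x 0; rewrite /continuous_at rmul0r in c.
have n : nbhs 0 (rmul^~ x @^-1` (fun y => V y -> W y)) := c _ fV.
by apply: filterS n => r h Ar; split=> //; apply: h; exact: AV.
Qed.

Definition dcc := forall H : nat -> set R, (forall i, defin act (H i)) ->
  (forall i, H i.+1 `<=` H i) -> exists i, fi (H i) (H i.+1).

Lemma dcc_min (P : set R -> Prop) V : dcc -> (forall W, P W -> defin act W) -> P V ->
  exists W, [/\ P W, W `<=` V & forall W', P W' -> W' `<=` W -> fi W W'].
Proof.
move=> dc Pd PV; apply: contrapT => no.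
pose st := {W | P W /\ W `<=` V}.
have [u|f [f0 fS]] := @dependent_choice st
    (fun u t => sval t `<=` sval u /\ ~ fi (sval u) (sval t)) _ (exist _ V (conj PV (fun _ h => h))).
  case: u => W [PW WV]; apply: cid; apply: contrapT => h; apply: no.
  exists W; split=> // W' PW' WW; apply: contrapT => nf; apply: h.
  by exists (exist _ W' (conj PW' (subset_trans WW WV))).
have [i|i|i fi_i] := dc (fun n => sval (f n)).
- by apply: Pd; case: (svalP (f i)).
- by case: (fS i).
- by case: (fS i) => _; apply.
Qed.

Definition ann (E : seq R) : set R := [set r | forall e, e \in E -> rmul r e = 0].

Lemma ann_cons x E : ann (x :: E) = [set r | ann E r /\ [set 0] (rmul r x)].
Proof.
apply/seteqP; split=> r.
  move=> h; split=> [e eE|]; last by rewrite /= h // inE eqxx.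
  by apply: h; rewrite inE eE orbT.
by move=> [h hx] e; rewrite inE => /orP[/eqP->|/h].
Qed.

Lemma ann_defin E : defin act (ann E).
Proof.
elim: E => [|x E IH]; last by rewrite ann_cons; apply: defin_divr => //; exact: defin_set0.
by rewrite (_ : ann [::] = setT) //; [exact: definT|apply/seteqP; split].
Qed.

Lemma ann_lideal E : lideal (ann E).
Proof.
split; first exact: defin_csub (ann_defin E).
by move=> r x h e eE; rewrite -rmulA h // rmulr0.
Qed.

Lemma csub_fixed D : csub [set x | forall g, D g -> act g x = x].
Proof.
have -> : [set x | forall g, D g -> act g x = x] =
    \bigcap_(g in D) [set x | act g x = x] by [].
apply: csub_bigcap => g _.
have -> : [set x | act g x = x] = (fun x => act g x - x) @^-1` [set 0].
  apply/seteqP; split=> x /=; first by move=> ->; rewrite subrr.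
  by move/eqP; rewrite subr_eq0 => /eqP.
apply: csub_preimage; last exact: csub_set0.
  move=> x; apply: cts_cvg2; first exact: act_continuous.
  exact: opp_continuous.
by move=> x y; rewrite actB subBAC.
Qed.

(** * A left ideal [V] minimal among the non-torsion ones *)

Section Minimal.
Context {J : nat -> set R} {baseJ : ideal_base J}.
Variable V : set R.
Hypotheses (dV : defin act V) (lV : lideal V).
Hypothesis minV : forall L, defin act L -> lideal L -> L `<=` V ->
  ~ L `<=` torsion J -> fi V L.

(** Read modulo torsion and finite index: a multiplier that kills [E] kills [V], so [E] spans [V].
    For the empty list this says that [V] is torsion. *)
Definition good E := exists Y, [/\ lideal Y, Y `<=` V, fi V Y &
  forall y, Y y -> forall r, ann E r -> torsion J (rmul r y)].

(* With [A = ann E], the ideal [I = {s | A s x <= torsion}] of [A] is completely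
   prime and [A / I] is locally finite, hence countable; by Baire [I] has finite
   index in [A], and [A] sends a subgroup of finite index of [V] into torsion. *)
Lemma good_tail x E : V x -> good (x :: E) -> good E.
Proof.
move=> Vx [Y [lY YV fY gY]]; set A := ann E.
have lA : lideal A := ann_lideal E; have dA : defin act A := ann_defin E.
(* Induction on the torsion exponent of [r x]; at exponent 0 the element [r] annihilates [x :: E]
   and the hypothesis on [Y] applies. *)
have F1 r y : A r -> torsion J (rmul r x) -> Y y -> torsion J (rmul r y).
  move=> Ar [n _ hn] Yy; move: hn; rewrite /tor; move: {2}n => k.
  elim: k r Ar => [|k IH] r Ar h.
    by apply: gY => //; rewrite ann_cons.
  apply: (@torsion_div _ _ _ _ n) => s Js; rewrite rmulA; apply: IH.
    exact: lA.2.
  by rewrite -rmulA; exact: h.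
case: (pselect (forall r, A r -> torsion J (rmul r x))) => [h|nh].
  by exists Y; split=> // y Yy r Ar; apply: F1 => //; exact: h.
have fAx : fi V (rmul^~ x @` A).
  apply: minV; [exact: defin_imager|exact: lideal_image| |].
    by move=> _ [r _ <-]; exact: lV.2.
  by move=> h; apply: nh => r Ar; apply: h; exists r.
(* Otherwise [R r x] has finite index in [V] by minimality. When [s x = q r x], the difference
   [s - q r] kills [x :: E], so [s y] is torsion; as such [s] have finite index in [A], all of [A y]
   is torsion, against the choice of [t]. *)
have F2 y t r : Y y -> A t -> ~ torsion J (rmul t y) -> A r ->
    torsion J (rmul r y) -> torsion J (rmul r x).
  move=> Yy At nt Ar tr; apply: contrapT => nr; apply: nt.
  pose L := rmul^~ (rmul r x) @` setT.
  have lL : lideal L by apply: lideal_image; exact: lidealT.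
  have fL : fi V L.
    apply: minV; [exact: defin_imager definT|exact: lL| |].
      by move=> _ [s _ <-]; apply: lV.2; exact: lV.2.
    move=> h; apply: nr; apply: (@torsion_div _ _ _ _ 0%N) => s _; apply: h.
    by exists s.
  pose A' := [set s | A s /\ L (rmul s x)].
  have lA' : lideal A'.
    split; first exact: csub_divr x lA.1 lL.1.
    by move=> q s [As Ls]; split; [exact: lA.2|rewrite -rmulA; exact: lL.2].
  have fA' : fi A A' by apply: fi_divr fL => s _; exact: lV.2.
  apply: (torsion_mul_sub lA lA' fA') At => s [As [q _ qs]].
  have -> : rmul s y = rmul (s - rmul q r) y + rmul q (rmul r y).
    by rewrite rmulBl rmulA subrK.
  apply: torsionD; last exact: torsionM.
  apply: gY => //; rewrite ann_cons; split.
    by apply: (csubB lA.1) => //; exact: lA.2.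
  by rewrite /= rmulBl -rmulA qs subrr.
(* Restricting to [s x] in [Y] allows [F1] and [F2] to be applied at the point [s x]. *)
pose A' := [set s | A s /\ Y (rmul s x)].
have cA' : csub A' by exact: csub_divr x lA.1 lY.1.
have mA' r s : A' s -> A' (rmul r s).
  by move=> [As Ys]; split; [exact: lA.2|rewrite -rmulA; exact: lY.2].
pose I := [set s | forall t, A t -> torsion J (rmul t (rmul s x))].
have I0 : I 0 by move=> t _; rewrite rmul0r rmulr0; exact: torsion0.
have IB r s : I r -> I s -> I (r - s).
  move=> Ir Is t At; rewrite rmulBl rmulBr.
  by apply: torsionB; [exact: Ir|exact: Is].
have absorb r s : A' r -> A' s -> I r \/ I s -> I (rmul r s).
  move=> [Ar Yr] [As Ys] [Ir|Is] t At; rewrite -(rmulA r) rmulA.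
    by apply: F1 => //; [exact: lA.2|rewrite -rmulA; exact: Ir].
  by apply: Is; exact: lA.2.
have dom r s : A' r -> A' s -> I (rmul r s) -> I r \/ I s.
  move=> [Ar Yr] [As Ys] Irs; apply: contrapT => /not_orP[nr]; apply => t At.
  apply: contrapT => nt; apply: nr => q Aq; rewrite rmulA.
  apply: (F2 (rmul s x) t) => //; first exact: lA.2.
  by rewrite -rmulA [rmul r _]rmulA; exact: Irs.
have [c hc] : exists c : (nat * nat) * nat -> R,
    forall s, A' s -> exists2 k, A' (c k) & I (s - c k).
  apply: (@countable_classes _ rmul) => // X XA'.
  pose D := fixes [set` X].
  have bD : large act D by apply: large_fixes; exact: finite_seq.
  pose S := A' `&` [set s | forall g, D g -> act g s = s].
  have cS : csub S by apply: csubI => //; exact: csub_fixed.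
  exists S; first by move=> s sX; split; [exact: XA'|move=> g; exact].
  (* Local finiteness: the elements of [A'] fixed by [D] form a subring containing [X], finite
     because the large group [D] acts trivially on it. *)
  split.
  - exact: csub0.
  - by move=> r s; exact: csubB.
  - move=> r s [Ar fr] [As fs]; split; first exact: mA'.
    by move=> g Dg; rewrite act_rmul fr // fs.
  - by move=> r s [Ar _] [As _]; exact: absorb.
  - by move=> r s [Ar _] [As _]; exact: dom.
  - by move=> r s t _ _ _; rewrite rmulA subrr.
  - by move=> r s t _ _ _; rewrite rmulDl subrr.
  - by move=> r s t _ _ _; rewrite rmulDr subrr.
  have fS : fi S [set 0].
    apply: (fi_of_trivial bD cS csub_set0) => g s Dg [_ fs].
    by rewrite /= fs // subrr.
  have [l [lS hl]] := fi_cover cS fS.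
  exists l => s Ss; have [d dl ds] := hl _ Ss; exists d => //.
  by split; [exact: lS|rewrite ds].
pose I' n := [set s | A' s /\ forall t, A t -> tor J n (rmul t (rmul s x))].
have cI' n : csub (I' n).
  have -> : I' n = A' `&` \bigcap_(t in A)
      ((fun s => rmul t (rmul s x)) @^-1` tor J n) by [].
  apply: csubI => //; apply: csub_bigcap => t _; apply: csub_preimage.
  - move=> s; apply: (@continuous_comp _ _ _ (rmul^~ x) (rmul t)).
      exact: rmulr_continuous.
    exact: rmull_continuous.
  - by move=> r s; rewrite rmulBl rmulBr.
  - exact: (tor_lideal n).1.
have [n fn] : exists n, fi A' (I' n).
  suff [i hi] : exists i : ((nat * nat) * nat) * nat, fi A' (I' i.2) by exists i.2.
  apply: (@fi_of_cosets _ _ _ A' (fun i => I' i.2) (fun i s => I' i.2 (s - c i.1))) => //.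
    move=> s As; have [k Ak Ik] := hc s As.
    have [_ [t At <-]|m hm] := lideal_torsion (lideal_image (rmul (s - c k) x) lA).
      exact: Ik.
    exists (k, m); split=> /= [|t At]; first exact: csubB.
    by apply: hm; exists t.
  by move=> i r s Ar As Pr Ps; rewrite -(subBB _ _ (c i.1)); exact: csubB.
pose Y1 := [set y | Y y /\ forall t, A t -> tor J n (rmul t y)].
have cY1 : csub Y1.
  have -> : Y1 = Y `&` \bigcap_(t in A) (rmul t @^-1` tor J n) by [].
  apply: csubI; first exact: lY.1.
  apply: csub_bigcap => t _; apply: csub_preimage; [|exact: rmulBr|].
    exact: rmull_continuous.
  exact: (tor_lideal n).1.
have fA' : fi A A' by apply: fi_divr fY => s _; exact: lV.2.
have fY1 : fi V Y1.
  apply: fi_trans fAx _.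
  apply: (@fi_transport _ _ (fun h s => h = rmul s x) _ _ A (I' n)) => //.
  - exact: (lideal_image x lA).1.
  - exact: lA.1.
  - exact: fi_trans fA' fn.
  - by move=> _ [s As <-]; exists s.
  - move=> _ _ r s _ _ Ar As -> -> [[Ars Yrs] Irs].
    by rewrite -rmulBl; split.
(* [Y1] need not be a left ideal; its points whose left multiples stay in it form one, and the index
   remains finite since [R y] is small for [y] near 0. *)
exists [set y | Y1 y /\ forall q, Y1 (rmul q y)]; split.
- split; last first.
    move=> r y [Yy hy]; split=> [|q]; first exact: hy.
    by rewrite rmulA; exact: hy.
  have -> : [set y | Y1 y /\ forall q, Y1 (rmul q y)] =
      Y1 `&` \bigcap_(q in setT) (rmul q @^-1` Y1).
    by apply/seteqP; split=> y [Yy hy]; split=> // q; [move=> _|]; exact: hy.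
  apply: csubI => //; apply: csub_bigcap => q _; apply: csub_preimage => //.
    exact: rmull_continuous.
  exact: rmulBr.
- by move=> y [[/YV]].
- have nY : nbhs 0 (fun y => V y -> Y1 y) := fY1.
  apply: filterS (filterI nY (near_rmulr nY)) => y [h hq] Vy; split; first exact: h.
  by move=> q; apply: hq; exact: lV.2.
- by move=> y [[_ h] _] r Ar; exists n => //; exact: h.
Qed.

(** Choose [E] in [V] with [ann E] minimal up to finite index. Adjoining any [y] of [V] leaves a
    subgroup of finite index, which kills [y], so [ann E] already sends [y] into torsion. Then
    [good_tail] empties the list. *)
Lemma minimal_torsion : dcc -> V `<=` torsion J.
Proof.
move=> dc.
have [||A [[E [EV ->]] _ minE]] := @dcc_min
    (fun A => exists E : seq R, (forall e, e \in E -> V e) /\ A = ann E) (ann [::]) dc.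
- by move=> _ [E [_ ->]]; exact: ann_defin.
- by exists [::].
have gE : good E.
  exists V; split=> //; first exact: fiW.
  move=> y Vy; apply: (torsion_mul_sub (ann_lideal E) (ann_lideal (y :: E))).
    apply: minE; last by move=> r; rewrite ann_cons => -[].
    by exists (y :: E); split=> // e; rewrite inE => /orP[/eqP->|/EV].
  by move=> r; rewrite ann_cons => -[_ ->]; exact: torsion0.
have [Y [lY YV fY gY]] : good [::].
  elim: E EV gE {minE} => [//|x E IH] EV gE; apply: IH.
    by move=> e eE; apply: EV; rewrite inE eE orbT.
  by apply: good_tail gE; apply: EV; rewrite inE eqxx.
apply: torsion_fi fY _ => // y Yy.
by apply: (@torsion_div _ _ _ _ 0%N) => r _; exact: gY.
Qed.

End Minimal.

Lemma dcc_nilpotent_by_finite : dcc -> nilpotent_by_finite R.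
Proof.
move=> dc; have [J bJ] := ideal_base_exists.
apply: (@nilpotent_by_finite_torsion _ _ J) => //.
apply: contrapT => nT.
have [W []||V [[dV lV nV] _ minV]] := @dcc_min
    (fun V => [/\ defin act V, lideal V & ~ V `<=` torsion J]) setT dc.
- by [].
- by split; [exact: definT|exact: lidealT|].
apply: nV; apply: minimal_torsion => // L dL lL LV nL.
by apply: minV.
Qed.

End Definable.
Arguments dcc {R G} act.

(** * Rings of finite rank *)

Section Bilinear.
Context {R : topologicalRngType} {G : topologicalGroupType} {act : G -> R -> R}
  {sma : small_action act}.
Implicit Types (H I W X Y : set R) (D : set G) (g : G) (b r s u v w x y : R).

Local Notation fixes B := (pointwise_stabilizer act B).

Definition bounded_dcc n := forall H : nat -> set R, (forall i, defin act (H i)) ->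
  (forall i, H i.+1 `<=` H i) -> exists2 i, (i <= n)%N & fi (H i) (H i.+1).

Lemma acc_max n (P : set R -> Prop) X : bounded_dcc n -> (forall W, P W -> defin act W) ->
  P X -> exists W, [/\ P W, X `<=` W & forall W', P W' -> W `<=` W' -> fi W' W].
Proof.
move=> dc Pd PX; apply: contrapT => no.
pose st := {W | P W /\ X `<=` W}.
have [t|f [f0 fS]] := @dependent_choice st
    (fun t t' => sval t `<=` sval t' /\ ~ fi (sval t') (sval t)) _
    (exist _ X (conj PX (fun _ h => h))).
  case: t => W [PW XW]; apply: cid; apply: contrapT => h; apply: no.
  exists W; split=> // W' PW' WW; apply: contrapT => nf; apply: h.
  by exists (exist _ W' (conj PW' (subset_trans XW WW))).
(* The ascending chain read backwards from term [n.+1]. Truncated subtraction makes it constant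
   afterwards, and the bound [i <= n] places the step of finite index in the strict part. *)
have [i|i|i iN] := dc (fun i => sval (f (n.+1 - i)%N)).
- by apply: Pd; case: (svalP (f (n.+1 - i)%N)).
- rewrite subSS; case: (leqP i n) => [iN|nI]; last first.
    by have [/eqP-> /eqP->] : (n - i == 0)%N /\ (n.+1 - i == 0)%N by rewrite !subn_eq0 nI ltnW.
  by rewrite subSn //; case: (fS (n - i)%N).
by rewrite subSS subSn //; case: (fS (n - i)%N) => _ nf /nf.
Qed.

(** * A subgroup [V] minimal over [V0], and the multipliers that kill [V0] *)

Section Descent.
Variables V0 V : set R.
Hypotheses (dV0 : defin act V0) (dV : defin act V) (V0V : V0 `<=` V).
Hypothesis nV : ~ fi V V0.
Hypothesis minV : forall X, defin act X -> V0 `<=` X -> X `<=` V -> ~ fi X V0 -> fi V X.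

Let cV0 := defin_csub dV0.
Let cV := defin_csub dV.

Definition killer := [set b | forall v, V0 v -> rmul b v = 0].
Hypothesis nK : nbhs 0 killer.

Lemma killer_csub : csub killer.
Proof.
have -> : killer = \bigcap_(v in V0) ((rmul^~ v) @^-1` [set 0]) by [].
apply: csub_bigcap => v _; apply: csub_preimage; last exact: csub_set0.
  exact: rmulr_continuous.
exact: rmulBl.
Qed.

Definition good_target W := exists V', [/\ csub V', V' `<=` V, fi V V' &
  \forall b \near (0 : R), forall v, V' v -> W (rmul b v)].

Definition cofinite Y := [/\ csub Y, V0 `<=` Y, Y `<=` V & fi V Y].

Lemma cofinite_defin Y : cofinite Y -> defin act Y.
Proof. by move=> [cY _ YV fY]; exact: defin_fi dV cY YV fY. Qed.

Lemma cofiniteI X Y : cofinite X -> cofinite Y -> cofinite (X `&` Y).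
Proof.
move=> [cX X0 XV fX] [cY Y0 YV fY]; split; first exact: csubI.
- by move=> x h; split; [exact: X0|exact: Y0].
- by move=> x [/XV].
- exact: fiI.
Qed.

Lemma good_targetP W : csub W -> good_target W -> exists2 V', cofinite V' &
  \forall b \near (0 : R), forall v, V' v -> W (rmul b v).
Proof.
move=> cW [V' [cV' V'V fV' hV']]; exists (sumset V' V0).
  split; [exact: csub_sumset|exact: sumsetr|exact: sumset_sub|].
  by apply: fi_trans fV' _; apply: fiW; exact: sumsetl.
apply: filterS (filterI hV' nK) => b [h kb] v [u V'u V0v].
by rewrite -(subrK u v) rmulDr (kb _ V0v) add0r; exact: h.
Qed.

Definition span (a : seq R) := foldr (fun x W => sumset (rmul x @` V) W) [set 0] a.

Lemma span_defin a : defin act (span a).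
Proof.
elim: a => [|x a IH]; first exact: defin_set0.
by apply: defin_sumset => //; exact: defin_imagel.
Qed.

(** Take a span maximal up to finite index. Adjoining [b] enlarges it only finitely, so [b] sends
    some [B l] into it; Baire over [l] makes one [l] serve all [b] near 0. *)
Lemma good_span n : bounded_dcc n -> exists a, (forall x, x \in a -> killer x) /\
  good_target (span a).
Proof.
move=> dc.
have [||Wa [[a [ka ->]] _ maxW]] := @acc_max n
    (fun W => exists a : seq R, (forall x, x \in a -> killer x) /\ W = span a)
    (span [::]) dc.
- by move=> _ [a [_ ->]]; exact: span_defin.
- by exists [::].
exists a; split=> //; set W := span a in maxW *.
have cW : csub W := defin_csub (span_defin a).
have [B [hB sB bB]] := subgroup_base cV.
have [l fl] : exists l, fi killer (killer `&` [set b | forall v, B l v -> W (rmul b v)]).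
  apply: (@fi_of_cosets _ _ nat killer _ (fun l b => forall v, B l v -> W (rmul b v)) killer_csub).
  - move=> l; apply: csubI; first exact: killer_csub.
    have -> : [set b | forall v, B l v -> W (rmul b v)] =
        \bigcap_(v in B l) ((rmul^~ v) @^-1` W) by [].
    apply: csub_bigcap => v _; apply: csub_preimage => //.
      exact: rmulr_continuous.
    exact: rmulBl.
  - move=> b kb.
    have fb : fi (span (b :: a)) W.
      apply: maxW; last by apply: sumsetr; exact: (csub_image (@rmull_continuous R b) (rmulBr b) cV).
      by exists (b :: a); split=> // x; rewrite inE => /orP[/eqP->|/ka].
    have [|l hl] := bB _ (csub_divl b cV cW).
      have c := @rmull_continuous R b 0; rewrite /continuous_at rmulr0 in c.
      have nb : nbhs 0 (rmul b @^-1` (fun y => span (b :: a) y -> W y)) := c _ fb.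
      apply: filterS nb => v hv Vv; split=> //; apply: hv.
      by apply: (@sumsetl _ _ _ cW); exists v.
    by exists l => v /hl[].
  - move=> l b b' kb kb' hb hb'; split; first exact: csubB killer_csub _ _ kb kb'.
    by move=> v Bv; rewrite rmulBl; apply: (csubB cW); [exact: hb|exact: hb'].
have [cB BV fB] := hB l.
exists (B l); split=> //.
have fl' : nbhs 0 (fun b => killer b -> (killer `&` [set b | forall v, B l v -> W (rmul b v)]) b) := fl.
by apply: filterS (filterI fl' nK) => b [h /h[]].
Qed.

(** The connected component of [V] over [V0], as seen by closed subgroups of finite index. By
    minimality of [V] it is either finite over [V0] or of finite index in [V]. *)
Definition residual := \bigcap_(Y in cofinite) Y.

Lemma cofiniteV : cofinite V.
Proof. by split=> //; exact: fiW. Qed.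

Lemma residual_sub Y : cofinite Y -> residual `<=` Y.
Proof. by move=> hY x; apply. Qed.

Lemma V0_residual : V0 `<=` residual.
Proof. by move=> x Vx Y [_ + _ _]; apply. Qed.

Lemma residual_defin : defin act residual.
Proof.
have cr : csub residual by apply: csub_bigcap => Y [].
apply: defin_stab cr (largeI (defin_large dV) (defin_large dV0)) _ => g x [sV sV0] hx Y [cY Y0 YV fY].
have : cofinite (V `&` act g @^-1` Y); last by move=> /hx[].
split.
- apply: csubI => //; apply: csub_preimage => //; [exact: act_continuous|exact: actB].
- by move=> v V0v; split; [exact: V0V|apply: Y0; exact: (sV0 v).1].
- by move=> v [].
have c := @act_continuous _ _ _ sma g 0; rewrite /continuous_at act0 in c.
have ng : nbhs 0 (act g @^-1` (fun y => V y -> Y y)) := c _ fY.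
by apply: filterS ng => v h Vv; split=> //; apply: h; exact: (sV v).1.
Qed.

(** * Endomorphisms of [V2] modulo [residual], up to those of finite image *)

Section Endomorphism.
Variable V2 : set R.
Hypothesis hV2 : cofinite V2.

Let cV2 : csub V2. Proof. by case: hV2. Qed.

Let rV2 : residual `<=` V2. Proof. exact: residual_sub. Qed.

Let cr : csub residual. Proof. exact: defin_csub residual_defin. Qed.

(* Representatives of the continuous endomorphisms of [V2 / residual] that
   commute with [D]. *)
Record endo D (f : R -> R) : Prop := {
  endo_maps : forall v, V2 v -> V2 (f v) ;
  endo_res : forall v, residual v -> residual (f v) ;
  endo_sub : forall v w, V2 v -> V2 w -> residual (f (v - w) - (f v - f w)) ;
  endo_act : forall g v, D g -> V2 v -> residual (f (act g v) - act g (f v)) ;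
  endo_fi : forall Y, cofinite Y -> fi V [set v | V2 v /\ Y (f v)] }.

Definition eker (f : R -> R) := [set v | V2 v /\ residual (f v)].

Lemma endo_congr D f v w : endo D f -> V2 v -> V2 w -> residual (v - w) ->
  residual (f v - f w).
Proof.
move=> ef Vv Vw /(endo_res ef) h; rewrite -(subKr (f (v - w)) (f v - f w)).
by apply: (csubB cr) => //; exact: (endo_sub ef).
Qed.

Lemma endo_preimage D f Y : endo D f -> cofinite Y ->
  cofinite [set v | V2 v /\ Y (f v)].
Proof.
move=> ef hY; have fY := endo_fi ef hY; have [cY Y0 YV _] := hY.
have V2V : V2 `<=` V by case: hV2.
split=> //; last by move=> v [/V2V].
  apply: (csub_of_fi cV) fY => [v [/V2V]//||v w [Vv Yv] [Vw Yw]].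
    split; first exact: csub0.
    by apply: (residual_sub hY); apply: (endo_res ef); exact: csub0.
  split; first exact: csubB.
  rewrite -(subrK (f v - f w) (f (v - w))); apply: (csubD cY); last exact: csubB.
  by apply: (residual_sub hY); exact: (endo_sub ef).
move=> v V0v; split; first by apply: rV2; exact: V0_residual.
by apply: (residual_sub hY); apply: (endo_res ef); exact: V0_residual.
Qed.

Lemma eker_csub D f : endo D f -> csub (eker f).
Proof.
move=> ef; have -> : eker f = \bigcap_(Y in cofinite) [set v | V2 v /\ Y (f v)].
  apply/seteqP; split=> v; first by move=> [Vv rv] Y hY; split=> //; exact: rv.
  by move=> h; split=> [|Y /h[]//]; have [] := h V cofiniteV.
by apply: csub_bigcap => Y /(endo_preimage ef)[].
Qed.

Lemma residual_eker D f : endo D f -> residual `<=` eker f.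
Proof. by move=> ef v rv; split; [exact: rV2|exact: (endo_res ef)]. Qed.

Definition stabilizes D := forall g, D g -> stab act V2 g /\ stab act residual g.

Lemma eker_act D f g v : endo D f -> stabilizes D -> D g -> eker f v -> eker f (act g v).
Proof.
move=> ef sD Dg [Vv rv]; have [s2 sr] := sD _ Dg; split; first exact: (s2 v).1.
rewrite -(subrK (act g (f v)) (f (act g v))); apply: (csubD cr).
  exact: (endo_act ef).
exact: (sr _).1.
Qed.

Lemma eker_defin D f : large act D -> stabilizes D -> endo D f -> defin act (eker f).
Proof.
move=> bD sD ef; apply: defin_stab (eker_csub ef) bD _ => g v Dg.
exact: eker_act ef sD Dg.
Qed.

Lemma eker_cofinite D f : endo D f -> fi V (eker f) -> cofinite (eker f).
Proof.
move=> ef ff; split=> //; first exact: eker_csub ef.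
- by move=> v V0v; apply: (residual_eker ef); exact: V0_residual.
- by move=> v [Vv _]; have [_ _ V2V _] := hV2; exact: V2V.
Qed.

(** Schur's lemma up to finite index: the kernel is definable and lies between [V0] and [V]. *)
Lemma eker_small D f : large act D -> stabilizes D -> endo D f ->
  ~ fi V (eker f) -> fi (eker f) V0.
Proof.
move=> bD sD ef nf; apply: contrapT => h; apply: nf; apply: minV => //.
- exact: eker_defin ef.
- by move=> v V0v; apply: (residual_eker ef); exact: V0_residual.
- by move=> v [Vv _]; have [_ _ V2V _] := hV2; exact: V2V.
Qed.

Lemma endo0 D : endo D (0 : R -> R).
Proof.
have z (v : R) : (0 : R -> R) v = 0 by [].
have [_ _ _ fV2] := hV2.
split=> [v _|v _|v w _ _|g v _ _|Y hY]; rewrite ?z ?act0 ?subrr ?subr0; try exact: csub0.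
apply: fi_trans fV2 _; apply: fiW => v Vv; split=> //; rewrite z.
by have [cY _ _ _] := hY; exact: csub0.
Qed.

Lemma endoB D f h : stabilizes D -> endo D f -> endo D h -> endo D (f - h).
Proof.
move=> sD ef eh; have z v : (f - h) v = f v - h v by [].
split=> [v Vv|v rv|v w Vv Vw|g v Dg Vv|Y hY]; rewrite ?z.
- by apply: (csubB cV2); [exact: (endo_maps ef)|exact: (endo_maps eh)].
- by apply: (csubB cr); [exact: (endo_res ef)|exact: (endo_res eh)].
- rewrite [f v - h v - _]subBAC [X in residual X]subBAC.
  by apply: (csubB cr); [exact: (endo_sub ef)|exact: (endo_sub eh)].
- rewrite actB [X in residual X]subBAC.
  by apply: (csubB cr); [exact: (endo_act ef)|exact: (endo_act eh)].
have [cY _ _ _] := hY; apply: fi_trans (fiI (endo_fi ef hY) (endo_fi eh hY)) _.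
by apply: fiW => v [[Vv Yf] [_ Yh]]; split=> //; rewrite z; exact: csubB.
Qed.

Lemma endo_comp D f h : stabilizes D -> endo D f -> endo D h -> endo D (f \o h).
Proof.
move=> sD ef eh; have mh := endo_maps eh.
split=> [v Vv|v rv|v w Vv Vw|g v Dg Vv|Y hY] /=.
- by apply: (endo_maps ef); exact: mh.
- by apply: (endo_res ef); exact: (endo_res eh).
- rewrite -(subBD _ _ (f (h v - h w))); apply: (csubD cr).
    apply: (endo_congr ef); [apply: mh; exact: csubB|apply: (csubB cV2); exact: mh|].
    exact: (endo_sub eh).
  by apply: (endo_sub ef); exact: mh.
- have [s2 _] := sD _ Dg.
  rewrite -(subBD _ _ (f (act g (h v)))); apply: (csubD cr).
    apply: (endo_congr ef); [apply: mh; exact: (s2 v).1|apply: (s2 _).1; exact: mh|].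
    exact: (endo_act eh).
  by apply: (endo_act ef) => //; exact: mh.
apply: fi_trans (endo_fi eh (endo_preimage ef hY)) _.
by apply: fiW => v [Vv [_ Yv]].
Qed.

(** Kernels are [D]-invariant, so otherwise each of the countably many orbits meeting [V2] would lie
    in a kernel of infinite index, against Baire. *)
Lemma generic_vector D : large act D -> stabilizes D ->
  exists v, V2 v /\ forall f, endo D f -> eker f v -> fi V (eker f).
Proof.
move=> bD sD; apply: contrapT => no.
have ex v : V2 v -> exists f, [/\ endo D f, eker f v & ~ fi V (eker f)].
  move=> Vv; apply: contrapT => h; apply: no; exists v; split=> // f ef fv.
  by apply: contrapT => nf; apply: h; exists f.
have [z hz] := large_orbits bD.
have exK i : exists K, [/\ csub K, ~ fi V K & forall w, V2 w ->
    (exists2 g, D g & w = act g (z i)) -> K w].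
  case: (pselect (exists w, V2 w /\ exists2 g, D g & w = act g (z i))); last first.
    by move=> h; exists V0; split=> // w Vw gw; case: h; exists w.
  move=> [w [Vw [g Dg wE]]]; have [f [ef fw nf]] := ex w Vw.
  exists (eker f); split=> //; first exact: eker_csub ef.
  move=> w' _ [g' Dg' ->].
  have -> : act g' (z i) = act (g' * g^-1)%g w by rewrite wE actM actK.
  by apply: (eker_act ef sD) => //; apply: (largeM bD) => //; exact: (largeV bD).
have [K hK] := choice exK.
have [i fK] : exists i, fi V2 (K i).
  apply: (@fi_of_cosets _ _ _ V2 K (fun i w => exists2 g, D g & w = act g (z i))) => //.
    by move=> i; case: (hK i).
  move=> i w w' Vw Vw' gw gw'; have [cK _ h] := hK i.
  by apply: (csubB cK); exact: h.
have [_ nK' _] := hK i; apply: nK'; apply: fi_trans fK; by case: hV2.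
Qed.

(** An endomorphism is determined, up to finite image, by its value at a generic [v]. That value is
    fixed modulo [residual] by the stabilizer of [v] in [D], which leaves finitely many classes. *)
Lemma endo_finite D : large act D -> stabilizes D -> exists s : seq (R -> R),
  forall f, endo D f -> exists2 h, h \in s & endo D h /\ fi V (eker (f - h)).
Proof.
move=> bD sD; have [v [Vv gv]] := generic_vector bD sD.
pose Hv := V2 `&` \bigcap_(g in [set g | D g /\ act g v = v])
  ((fun u => act g u - u) @^-1` residual).
have cHv : csub Hv.
  apply: csubI => //; apply: csub_bigcap => g _; apply: csub_preimage => //.
    move=> x; apply: cts_cvg2; first exact: act_continuous.
    exact: opp_continuous.
  by move=> x y; rewrite actB subBAC.
have fHv : fi Hv residual.
  apply: (fi_of_trivial (largeI bD (large_fixes1 v)) cHv cr) => g u [Dg gv'] [_ hu].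
  exact: hu.
have [cs [_ hcs]] := fi_cover cHv fHv.
have ex c : exists h, endo D h /\
    ((exists f, endo D f /\ residual (f v - c)) -> residual (h v - c)).
  case: (pselect (exists f, endo D f /\ residual (f v - c))) => [[f [ef h]]|no].
    by exists f.
  by exists 0; split=> //; exact: endo0.
have [h hh] := choice ex.
exists [seq h c | c <- cs] => f ef.
have Hf : Hv (f v).
  split; first exact: (endo_maps ef).
  by move=> g [Dg gv']; have := endo_act ef Dg Vv; rewrite gv' -opprB => /(csubN cr); rewrite opprK.
have [c ccs rc] := hcs _ Hf; exists (h c); first exact: map_f.
have [eh hc] := hh c; split=> //; apply: gv; first exact: endoB.
split=> //; have -> : (f - h c) v = f v - h c v by [].
rewrite -(subBB _ _ c); apply: (csubB cr) => //; apply: hc; by exists f.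
Qed.

Lemma endo_domain D : large act D -> stabilizes D ->
  @finite_domain_mod (R -> R) (fun f h => f \o h) (endo D) [set f | fi V (eker f)].
Proof.
move=> bD sD; have [_ _ V2V fV2] := hV2.
have all_res (f : R -> R) : (forall v, V2 v -> residual (f v)) -> fi V (eker f).
  by move=> h; apply: fi_trans fV2 _; apply: fiW => v Vv; split=> //; exact: h.
split.
- exact: endo0.
- by move=> f h; exact: endoB.
- by move=> f h; exact: endo_comp.
- move=> f h ef eh [ff|fh].
    apply: fi_trans (endo_fi eh (eker_cofinite ef ff)) _.
    by apply: fiW => v [Vv [_ rv]].
  apply: fi_trans fh _; apply: fiW => v [Vv rv]; split=> //=.
  exact: (endo_res ef).
- move=> f h ef eh ffh; apply: contrapT => /not_orP[nf]; apply.
  apply: fi_trans ffh _.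
  have efh := endo_comp sD ef eh.
  apply: (@fi_transport _ _ (fun v u => u = h v) _ _ (eker f) V0).
  + exact: eker_csub efh.
  + exact: eker_csub eh.
  + exact: eker_csub ef.
  + exact: eker_small ef nf.
  + by move=> v [Vv rv]; exists (h v) => //; split=> //; exact: (endo_maps eh).
  + move=> v w u u' [Vv _] [Vw _] _ _ -> -> V0h; split; first exact: csubB.
    rewrite -(subrK (h v - h w) (h (v - w))); apply: (csubD cr).
      exact: (endo_sub eh).
    exact: V0_residual.
- move=> f h k _ _ _; apply: all_res => v _.
  have -> : ((f \o (h \o k)) - ((f \o h) \o k)) v = 0 := subrr (f (h (k v))).
  exact: csub0.
- move=> f h k _ _ _; apply: all_res => v _.
  have -> : (((f + h) \o k) - ((f \o k) + (h \o k))) v = 0 := subrr (f (k v) + h (k v)).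
  exact: csub0.
- move=> f h k ef eh ek; apply: all_res => v Vv.
  have -> : ((f \o (h + k)) - ((f \o h) + (f \o k))) v =
      f (h v + k v) - (f (h v) + f (k v)) by [].
  have Vh := endo_maps eh Vv; have Vk := endo_maps ek Vv.
  have := endo_sub ef (csubD cV2 Vh Vk) Vk; rewrite addrK => /(csubN cr).
  by rewrite opprB opprD addrA addrAC.
- have [s hs] := endo_finite bD sD.
  by exists s => f /hs.
Qed.

End Endomorphism.

(** * Removing one generator [a] from the target *)

Section Step.
Variables (a : R) (W1 : set R).
Hypotheses (ka : killer a) (dW1 : defin act W1).
Let cW1 := defin_csub dW1.
Let W := sumset (rmul a @` V) W1.
Let N := [set v | V v /\ W1 (rmul a v)].

Let dN : defin act N. Proof. exact: defin_divl. Qed.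

Let cN := defin_csub dN.

Let V0N : V0 `<=` N.
Proof. by move=> v V0v; split; [exact: V0V|rewrite ka //; exact: csub0]. Qed.

Let W_rel w : W w -> exists2 v, V v & W1 (w - rmul a v).
Proof. by move=> [_ [v Vv <-] h]; exists v. Qed.

Let cW : csub W.
Proof. by apply: csub_sumset => //; apply: defin_csub; exact: defin_imagel. Qed.

Lemma fi_target Y : csub Y -> fi V Y -> fi W (sumset (rmul a @` (Y `&` V)) W1).
Proof.
move=> cY fY; have cYV := csubI cY cV.
apply: (@fi_transport _ _ (fun w v => W1 (w - rmul a v)) W _ V (Y `&` V)) => //.
- by apply: csub_sumset => //; apply: csub_image => //; [exact: rmull_continuous|exact: rmulBr].
- by apply: fiI => //; exact: fiW.
- move=> w w' v v' _ _ _ _ h h' Yv; exists (rmul a (v - v')); first by exists (v - v').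
  by rewrite rmulBr subBAC; exact: csubB.
Qed.

(** Since [b R] is small for [b] near 0, its part inside [W] falls into any subgroup with the same
    germ. *)
Lemma good_target_fi V' W' :
  (\forall b \near (0 : R), forall v, V' v -> W (rmul b v)) -> fi W W' ->
  \forall b \near (0 : R), forall v, V' v -> W' (rmul b v).
Proof.
move=> h fW; have nW : nbhs 0 (fun y => W y -> W' y) := fW.
by apply: filterS (filterI h (near_rmul nW)) => b [hb hb'] v /hb; exact: hb'.
Qed.

Lemma good_target_finite : good_target W -> fi V N -> good_target W1.
Proof.
move=> /(good_targetP cW)[V' hV' bV'] fN; exists V'; have [? ? ? ?] := hV'.
split=> //; apply: good_target_fi bV' _.
apply: fi_trans (fi_target cN fN) _; apply: fiW; apply: sumset_sub => //.
by move=> _ [v [[_ h] _] <-].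
Qed.

(* If [V / V0] is connected up to finite index, the subgroups [b V] cannot be
   small and infinite at the same time modulo [W1]. *)
Lemma good_target_connected : good_target W -> ~ fi V N -> ~ fi residual V0 ->
  good_target W1.
Proof.
move=> /(good_targetP cW)[V' hV' bV'] nN nres.
have rV : residual `<=` V := residual_sub cofiniteV.
have fres : fi V residual by apply: minV => //; [exact: residual_defin|exact: V0_residual].
have cres := defin_csub residual_defin.
have [u0 [ru0 nu0]] : exists u, residual u /\ ~ W1 (rmul a u).
  apply: contrapT => no; apply: nN; apply: fi_trans fres _; apply: fiW => u ru.
  by split; [exact: rV|apply: contrapT => h; apply: no; exists u].
exists residual; split=> //.
(* For [b] near 0 the set [b R + W1] thus misses [a u0]; the contradiction will come from showing
   that [b residual + W1] contains [a residual]. *)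
have nO : nbhs 0 [set o | ~ W1 (rmul a u0 - o)].
  have c := @subl_continuous R (rmul a u0) 0; rewrite /continuous_at subr0 in c.
  have nc : nbhs (rmul a u0) (~` W1).
    by apply: open_nbhs_nbhs; split=> //; apply/closed_openC; exact: csub_closed.
  exact: c _ nc.
apply: filterS (filterI (filterI bV' nK) (near_rmul nO)) => b [[hb kb] hO].
pose Xb := [set v | residual v /\ W1 (rmul b v)].
have dXb : defin act Xb by apply: defin_divl => //; exact: residual_defin.
have V0Xb : V0 `<=` Xb.
  by move=> v V0v; split; [exact: V0_residual|rewrite kb //; exact: csub0].
have XbV : Xb `<=` V by move=> v [/rV].
case: (pselect (fi Xb V0)) => [fXb|nXb]; last first.
  have hXb : cofinite Xb by split=> //; [exact: (defin_csub dXb)|exact: (minV dXb)].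
  by move=> v /(residual_sub hXb)[].
pose bW := sumset (rmul b @` residual) W1.
have dbW : defin act bW.
  by apply: defin_sumset => //; apply: defin_imagel; exact: residual_defin.
pose X' := [set u | V u /\ bW (rmul a u)].
have dX' : defin act X' by apply: defin_divl.
have hX' : cofinite X'.
  have V0X' : V0 `<=` X'.
    move=> v V0v; split; first exact: V0V.
    by rewrite ka //; exact: csub0 (defin_csub dbW).
  have X'V : X' `<=` V by move=> u [].
  split=> //; first exact: (defin_csub dX').
  apply: minV => //.
  (* Solving [b v = a u] modulo [W1] embeds [residual / Xb] into [X' / V0], so finiteness of [X']
     over [V0] would pass to [residual]. *)
  move=> fX'; apply: nres; apply: (fi_trans _ fXb).
  apply: (@fi_transport _ _ (fun v u => W1 (rmul b v - rmul a u)) _ _ X' V0) => //.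
  - exact: (defin_csub dXb).
  - exact: (defin_csub dX').
  - move=> v rv; have [u Vu h] := W_rel (hb v (residual_sub hV' rv)).
    exists u => //; split=> //; exists (rmul b v); first by exists v.
    by rewrite -opprB; exact: csubN.
  - move=> v v' u u' rv rv' _ _ h h' uu; split; first exact: csubB cres _ _ rv rv'.
    have := csubB cW1 h h'; rewrite subBAC -rmulBr -rmulBr.
    by rewrite (ka uu) subr0.
have [_ [_ [v rv <-] hv]] := residual_sub hX' ru0.
by case: (hO v).
Qed.

(* On a subgroup [V2] of finite index the congruence [b v = a (T b v)] modulo [W1]
   defines endomorphisms [T b] of [V2 / residual]. Modulo those of finite image
   they generate locally finite domains, so they fall into countably many
   classes, and [T b] has finite image when [b V] is finite modulo [W1]. *)
Lemma good_target_residual : good_target W -> ~ fi V N -> fi residual V0 ->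
  good_target W1.
Proof.
move=> /(good_targetP cW)[V' hV' bV'] nN fres.
have cr : csub residual := defin_csub residual_defin.
have fN : fi N V0 by apply: contrapT => h; apply: nN; apply: minV => // v [].
(* [N] is finite over [V0]: for each of the finitely many coset representatives outside [residual],
   intersect with a cofinite subgroup that misses it. On [V2] the element [a] then becomes injective
   modulo [residual] and [W1], so [T] is well defined modulo [residual]. *)
have [Y0 hY0 NY0] : exists2 Y, cofinite Y & N `&` Y `<=` residual.
  have [cs [csN hcs]] := fi_cover cN fN.
  have [Y hY cY] : exists2 Y, cofinite Y & forall c, c \in cs -> Y c -> residual c.
    elim: cs {csN hcs} => [|c cs [Y hY IH]]; first by exists V => //; exact: cofiniteV.
    case: (pselect (residual c)) => [rc|nc].
      by exists Y => // d; rewrite inE => /orP[/eqP->|/IH].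
    have [X hX nX] : exists2 X, cofinite X & ~ X c.
      apply: contrapT => h; apply: nc => X hX; apply: contrapT => nX.
      by apply: h; exists X.
    exists (Y `&` X); first exact: cofiniteI.
    by move=> d; rewrite inE => /orP[/eqP->|dcs] [Yd Xd] //; exact: IH.
  exists Y => // x [Nx Yx]; have [c ccs V0c] := hcs _ Nx.
  have rxc := V0_residual V0c; rewrite -(subrK c x); apply: (csubD cr) => //.
  apply: cY => //; rewrite -(subKr x c); have [cY' _ _ _] := hY.
  by apply: (csubB cY') => //; exact: residual_sub hY _ rxc.
pose V2 := V' `&` Y0; have hV2 : cofinite V2 := cofiniteI hV' hY0.
have [cV2 V0V2 V2V fV2] := hV2.
have NV2 v : V2 v -> W1 (rmul a v) -> residual v.
  by move=> V2v h; apply: NY0; split; [split=> //; exact: V2V|case: V2v].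
pose W2 := sumset (rmul a @` (V2 `&` V)) W1.
have cW2 : csub W2.
  apply: csub_sumset => //; apply: csub_image; last exact: csubI.
    exact: rmull_continuous.
  exact: rmulBr.
pose R3 := killer `&` \bigcap_(v in V2) ((rmul^~ v) @^-1` W2).
have cR3 : csub R3.
  apply: csubI; first exact: killer_csub.
  apply: csub_bigcap => v _; apply: csub_preimage => //.
    exact: rmulr_continuous.
  exact: rmulBl.
have nR3 : nbhs 0 R3.
  have h := good_target_fi bV' (fi_target cV2 fV2).
  by apply: filterS (filterI nK h) => b [kb hb]; split=> // v [V'v _]; exact: hb.
have exT (p : R * R) : exists u, R3 p.1 -> V2 p.2 -> V2 u /\ W1 (rmul p.1 p.2 - rmul a u).
  case: (pselect (R3 p.1 /\ V2 p.2)) => [[[_ h] Vv]|no]; last first.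
    by exists 0 => h h'; case: no.
  by have [_ [u [V2u _] <-] hu] := h _ Vv; exists u.
have [T hT] := choice exT.
have T2 b v : R3 b -> V2 v -> V2 (T (b, v)) by move=> Rb Vv; case: (hT (b, v) Rb Vv).
have TW b v : R3 b -> V2 v -> W1 (rmul b v - rmul a (T (b, v))).
  by move=> Rb Vv; case: (hT (b, v) Rb Vv).
have uniqT x u u' : V2 u -> V2 u' -> W1 (x - rmul a u) -> W1 (x - rmul a u') ->
    residual (u - u').
  move=> Vu Vu' h h'; apply: NV2; first exact: csubB.
  by have := csubB cW1 h' h; rewrite subBAC subrr sub0r opprB -rmulBr.
have TY b Y : R3 b -> cofinite Y -> exists2 X, cofinite X &
    forall v, X v -> V2 v /\ Y (T (b, v)).
  move=> Rb hY; have [cY Y0' YV fY] := hY; have cVY := csubI cV2 cY.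
  pose WY := sumset (rmul a @` (V2 `&` Y)) W1.
  have cWY : csub WY.
    by apply: csub_sumset => //; apply: csub_image => //;
      [exact: rmull_continuous|exact: rmulBr].
  exists [set v | V2 v /\ WY (rmul b v)]; last first.
    move=> v [Vv [_ [u [V2u Yu] <-] hu]]; split=> //.
    rewrite -(subrK u (T (b, v))); apply: (csubD cY) => //.
    by apply: (residual_sub hY); apply: uniqT hu => //; [exact: T2|exact: TW].
  split; first exact: csub_divl.
  - move=> v V0v; split; first exact: V0V2.
    by have [kb _] := Rb; rewrite kb //; exact: csub0.
  - by move=> v [/V2V].
  apply: fi_trans fV2 _.
  apply: (@fi_transport _ _ (fun v u => W1 (rmul b v - rmul a u)) _ _ V2 (V2 `&` Y)) => //.
  - exact: csub_divl.
  - by apply: fiI; [exact: fiW|apply: fi_trans fY; exact: fiW].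
  - by move=> v Vv; exists (T (b, v)); [exact: T2|exact: TW].
  - move=> v v' u u' Vv Vv' _ _ h h' VYu; split; first exact: csubB.
    exists (rmul a (u - u')); first by exists (u - u').
    by rewrite !rmulBr subBAC; exact: csubB.
(* Fixing [a] and [B] and preserving [W1] makes these elements commute, modulo [residual], with
   [T b] for each [b] of [B]. *)
pose Dn (B : set R) := stab act V2 `&` (stab act residual `&` (stab act W1 `&`
  ([set g | act g a = a] `&` fixes B))).
have lD B : finite_set B -> large act (Dn B).
  move=> fB; apply: largeI; first exact: (defin_large (cofinite_defin hV2)).
  apply: largeI; first exact: (defin_large residual_defin).
  apply: largeI; first exact: (defin_large dW1).
  by apply: largeI; [exact: large_fixes1|exact: large_fixes].
have sD B : stabilizes V2 (Dn B) by move=> g [? [? _]].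
have endoT B b : R3 b -> B b -> endo V2 (Dn B) (fun v => T (b, v)).
  move=> Rb Bb; split.
  - by move=> v; exact: T2.
  - by move=> v rv Y hY; have [X hX hXY] := TY b Y Rb hY; case: (hXY v (rv X hX)).
  - move=> v w Vv Vw; have Vvw := csubB cV2 Vv Vw.
    apply: (uniqT (rmul b (v - w))); [exact: T2|by apply: (csubB cV2); exact: T2|exact: TW|].
    by rewrite rmulBr rmulBr subBAC; apply: (csubB cW1); exact: TW.
  - move=> g v [s2 [sr [sW [ga gB]]]] Vv; have V2g : V2 (act g v) := (s2 v).1 Vv.
    apply: (uniqT (rmul b (act g v))); [exact: T2|apply: (s2 _).1; exact: T2|exact: TW|].
    have := (sW _).1 (TW b v Rb Vv).
    by rewrite actB !act_rmul ga (gB b).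
  - move=> Y hY; have [X hX hXY] := TY b Y Rb hY; have [_ _ _ fX] := hX.
    by apply: fi_trans fX _; apply: fiW => v /hXY.
(* Where [T b - T b'] has values in [residual], these are finite modulo [V0]; since [a] kills [V0],
   [b - b'] lands in [W1] on a subgroup of finite index. *)
have eq_killed b b' : R3 b -> R3 b' ->
    fi V (eker V2 ((fun v => T (b, v)) - (fun v => T (b', v)))) ->
    fi V [set v | V2 v /\ W1 (rmul (b - b') v)].
  move=> Rb Rb' h; pose B := [set b; b'].
  have fB : finite_set B by rewrite finite_setU; split.
  have eb : endo V2 (Dn B) (fun v => T (b, v)) by apply: endoT => //; left.
  have eb' : endo V2 (Dn B) (fun v => T (b', v)) by apply: endoT => //; right.
  have ee := endoB hV2 (sD B) eb eb'.
  apply: fi_trans h _.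
  apply: (@fi_transport _ _ (fun v u => W1 (rmul (b - b') v - rmul a u)) _ _ residual V0) => //.
  - exact: (eker_csub hV2 ee).
  - exact: csub_divl.
  - move=> v [Vv rv]; exists (T (b, v) - T (b', v)) => //.
    by rewrite rmulBl rmulBr subBAC; apply: (csubB cW1); exact: TW.
  - move=> v v' u u' [Vv _] [Vv' _] _ _ hv hv' V0u; split; first exact: csubB.
    by have := csubB cW1 hv hv'; rewrite subBAC -!rmulBr (ka V0u) subr0.
have [c hc] : exists c : (nat * nat) * nat -> R -> R,
    forall f, (exists2 b, R3 b & f = (fun v => T (b, v))) ->
    exists2 k, (exists2 b, R3 b & c k = (fun v => T (b, v))) & fi V (eker V2 (f - c k)).
  apply: (@countable_classes (R -> R) (fun f h => f \o h)
      [set f | exists2 b, R3 b & f = (fun v => T (b, v))] [set f | fi V (eker V2 f)]).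
  - apply: fi_trans fV2 _; apply: fiW => v Vv; split=> //; exact: (csub0 cr).
  - move=> f h ff fh; apply: fi_trans (fiI ff fh) _; apply: fiW => v [[Vv rf] [_ rh]].
    by split=> //; exact: csubB cr _ _ rf rh.
  move=> X hX.
  have exb f : exists b, f \in X -> R3 b /\ f = (fun v => T (b, v)).
    case: (pselect (f \in X)) => [/hX[b Rb fE]|nf]; first by exists b.
    by exists 0 => fX; case: nf.
  have [beta hb] := choice exb.
  pose B := [set` [seq beta f | f <- X]].
  have fB : finite_set B by exact: finite_seq.
  exists (endo V2 (Dn B)); last exact: (endo_domain hV2 (lD B fB) (sD B)).
  move=> f fX; have [Rb fE] := hb f fX; rewrite fE; apply: endoT => //.
  exact: map_f.
have exb k : exists b, (exists2 b', R3 b' & c k = (fun v => T (b', v))) ->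
    R3 b /\ c k = (fun v => T (b, v)).
  case: (pselect (exists2 b', R3 b' & c k = (fun v => T (b', v)))) => [[b Rb cE]|no].
    by exists b.
  by exists 0.
have [d hd] := choice exb.
have [B [hB sB bB]] := subgroup_base cV.
pose C l := R3 `&` \bigcap_(v in B l) ((rmul^~ v) @^-1` W1).
have cC l : csub (C l).
  apply: csubI => //; apply: csub_bigcap => v _; apply: csub_preimage => //.
    exact: rmulr_continuous.
  exact: rmulBl.
have [l fl] : exists l, fi R3 (C l).
  suff [i hi] : exists i : ((nat * nat) * nat) * nat, fi R3 (C i.2) by exists i.2.
  apply: (@fi_of_cosets _ _ _ R3 (fun i => C i.2) (fun i b => C i.2 (b - d i.1))) => //.
    move=> b Rb; have [|k ck fk] := hc (fun v => T (b, v)); first by exists b.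
    have [Rd cE] := hd k ck; rewrite cE in fk.
    have [l hl] := bB _ (csub_divl (b - d k) cV2 cW1) (eq_killed _ _ Rb Rd fk).
    by exists (k, l); split=> [|v /hl[]//]; exact: csubB.
  by move=> i b b' Rb Rb' h h'; rewrite -(subBB _ _ (d i.1)); exact: csubB.
have [cB BV fB] := hB l; exists (B l); split=> //.
have fl' : nbhs 0 (fun b => R3 b -> C l b) := fl.
by apply: filterS (filterI fl' nR3) => b [h /h[_]].
Qed.

Lemma good_target_step : good_target W -> good_target W1.
Proof.
move=> gW; case: (pselect (fi V N)) => [|nN]; first exact: good_target_finite.
case: (pselect (fi residual V0)); first exact: good_target_residual.
exact: good_target_connected.
Qed.

End Step.

Lemma annihilated_subgroup n : bounded_dcc n -> exists V', [/\ csub V', V' `<=` V, fi V V' &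
  \forall b \near (0 : R), forall v, V' v -> rmul b v = 0].
Proof.
move=> dc; have [a [ha ga]] := good_span dc.
suff : good_target [set 0] by [].
elim: a ha ga => [//|x a IH] ha ga; apply: IH.
  by move=> y ya; apply: ha; rewrite inE ya orbT.
apply: good_target_step ga; last exact: span_defin.
by apply: ha; rewrite inE eqxx.
Qed.

End Descent.

Lemma bounded_null_by_finite n : bounded_dcc n -> null_by_finite R.
Proof.
move=> dc.
have dc' : dcc act by move=> H dH sH; have [i _ h] := dc H dH sH; exists i.
pose P X := defin act X /\ nbhs 0 (killer X).
have [||V0 [[dV0 nK] _ maxV0]] := @acc_max n P [set 0] dc.
- by move=> X [].
- by split; [exact: defin_set0|apply: nearW => b v ->; exact: rmulr0].
have cV0 := defin_csub dV0.
have fV0 : fi setT V0.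
  apply: contrapT => nf.
  have [||V [[dV V0V nV] _ minV]] := @dcc_min R G act
      (fun X => [/\ defin act X, V0 `<=` X & ~ fi X V0]) setT dc'.
  - by move=> X [].
  - by split=> //; exact: definT.
  have [|V' [cV' V'V fV' hV']] := @annihilated_subgroup V0 V dV0 dV V0V nV _ nK n dc.
    by move=> X dX V0X XV nX; apply: minV.
  have cS : csub (sumset V' V0) by exact: csub_sumset.
  have SV : sumset V' V0 `<=` V by apply: sumset_sub => //; exact: defin_csub dV.
  have fS : fi V (sumset V' V0) by apply: fi_trans fV' _; apply: fiW; exact: sumsetl.
  have PS : P (sumset V' V0).
    split; first exact: defin_fi dV cS SV fS.
    apply: filterS (filterI hV' nK) => b [h kb] v [u V'u V0v].
    by rewrite -(subrK u v) rmulDr (kb _ V0v) add0r; exact: h.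
  by apply: nV; apply: fi_trans fS _; apply: maxV0 => //; exact: sumsetr.
have nV0 : nbhs 0 V0.
  have f : nbhs 0 (fun x => setT x -> V0 x) := fV0.
  by apply: filterS f => x; exact.
have cK := killer_csub V0.
(* An ideal inside both [killer V0] and [V0] has zero products: the left factor kills [V0] and the
   right factor lies in it. *)
have [I iI [nI IK]] := open_subgroup_ideal (csubI cK cV0) (filterI nK nV0).
exists I; split; last exact: open_finite_index.
split=> //; apply/seteqP; split=> [_ [x Ix [y Iy <-]]|x ->].
  by have [kx _] := IK _ Ix; have [_ V0y] := IK _ Iy; exact: kx.
by exists 0; [exact: ideal0|exists 0; [exact: ideal0|exact: rmulr0]].
Qed.

End Bilinear.

Lemma polish_base (K : realType) (T : topologicalType) : polish K T ->
  exists P : nat -> set T, forall (x : T) U, nbhs x U ->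
    exists2 k, nbhs x (P k) & P k `<=` U.
Proof.
move=> [[D /countable_injP[f finj] dD] [d [d0 dC dT dN _]]].
have d_self x : d x x = 0 by apply/d0.
have ball x e : 0 < e -> nbhs x [set y | d x y < e] by move=> e0; apply/dN; exists e.
exists (fun n => if unpickle n is Some (m, k) then
  [set y | exists2 c, D c /\ f c = m & d c y < k.+1%:R^-1] else set0) => x U.
move=> /dN[e e0 eU]; have e2 : 0 < e / 2 by rewrite divr_gt0.
have [k _ /(_ k (leqnn k)) /= ke] := near_infty_natSinv_lt (PosNum e2).
have k0 : 0 < k.+1%:R^-1 :> K by rewrite invr_gt0.
have [|c [/interior_subset /= xc Dc]] := dD _ _ (open_interior [set y | d x y < k.+1%:R^-1]).
  by exists x; exact: ball.
exists (pickle (f c, k)); rewrite pickleK.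
  apply/dN; exists (k.+1%:R^-1 - d x c); first by rewrite subr_gt0.
  move=> y /= xy; exists c => //; apply: le_lt_trans (dT c x y) _.
  by rewrite (dC c x) addrC -ltrBrDr.
move=> y [c' [Dc' fc'] /= cy]; apply: eU => /=.
have cc : c' = c by apply: finj => //; exact/mem_set.
rewrite cc in cy; apply: le_lt_trans (dT x c y) _.
by rewrite [e]splitr; apply: ltrD; [exact: lt_trans ke|exact: lt_trans ke].
Qed.

Theorem theorem4p2 (K : realType) (R : topologicalRngType)
    (G : topologicalGroupType) (act : G -> R -> R)
    (hRG : compact_G_ring K act) (hsmall : small act) :
  (nm_stable act -> nilpotent_by_finite R) /\
  (finite_NM_rank act -> null_by_finite R).
Proof.
have sma : small_action act.
  case: hRG => cR hR pG a1 aM aD aR _ aC; split=> //.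
  exact: polish_base pG.
split=> [stb|[n rk]].
  by apply: dcc_nilpotent_by_finite; exact: nm_stable_dcc.
by apply: (@bounded_null_by_finite _ _ act _ n); exact: finite_rank_dcc.
Qed.
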